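(* Let $\rho_0=\mathcal{GW}(\{q_k\})$ be a Galton-Watson measure on $\mathcal{T}^|$ with $q_1=0$ and $q_0<1$. Starting with $k=0$, and for each consecutive integer $k$, let $\nu_k=\mathcal{R}_*(\rho_k)$, i.e. $\nu_k(T)=\rho_k(\mathcal{R}^{-1}(T))$, and set $\rho_{k+1}(T)=\nu_k(T\mid T\neq\phi)$. (i) If $\rho_0$ is critical and the limit $S'(1)=\lim_{x\to1-}\frac{1-S(x)}{1-x}$ exists, then for every $T\in\mathcal{T}^|$, $$\lim_{k\to\infty}\rho_k(T)=\rho^*(T),$$ where $\rho^*$ is the invariant Galton-Watson measure $\mathcal{IGW}(q)$ with $q=1-S'(1)$. (ii) If $\rho_0$ is subcritical, then $\rho_k(T)$ converges, for every $T\in\mathcal{T}^|$, to the point mass measure $\mathcal{GW}(q_0=1)$.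
   Context: Trees. $\mathcal{T}^|$ denotes the set of finite unlabeled rooted trees that are planted (either the empty tree $\phi$ consisting of the root only, or the root has exactly one offspring) and reduced (no vertex of degree $2$; the degree of a non-root vertex is its number of offspring plus one). Galton-Watson measures. For a probability distribution $\{q_k\}_{k\ge 0}$ with $q_1=0$, $\mathcal{GW}(\{q_k\})$ is the law of the random tree whose root has a single offspring and in which every non-root vertex independently has $k$ offspring with probability $q_k$. It is critical if $\sum_k kq_k=1$ and subcritical if $\sum_k kq_k<1$; in these cases it is a probability measure on $\mathcal{T}^|$ giving mass zero to $\phi$. $\mathcal{GW}(q_0=1)$ is the point mass at the tree consisting of a root, one leaf, and the edge joining them. Let $Q(z)=\sum_{m\ge 0}q_mz^m$ (for the initial distribution $\{q_k\}$) and $S(z)=\frac{Q(z)-zQ'(z)}{1-Q'(z)}$ for $z\in[0,1)$. Horton pruning. $\mathcal{R}(T)$ for $T\neq\phi$ is obtained from $T$ by removing all leaves together with their parental edges, followed by series reduction (removing each non-root vertex of degree $2$ and merging its two adjacent edges into one); $\mathcal{R}(\phi)=\phi$. Invariant Galton-Watson measures. For $q\in[1/2,1)$, $\mathcal{IGW}(q)$ is the critical Galton-Watson measure whose offspring generating function is $Q(z)=z+q(1-z)^{1/q}$. For $q=1$ the same formula gives generating function identically $1$, and $\mathcal{IGW}(1)$ is understood as $\mathcal{GW}(q_0=1)$. *)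

(* Defs.v *)
From HB Require Import structures.
From Stdlib Require Import List.
From mathcomp Require Import all_boot all_order all_algebra.
From mathcomp Require Import all_classical all_reals all_analysis.
Set Implicit Arguments.
Unset Strict Implicit.
Unset Printing Implicit Defensive.
Import Order.TTheory GRing.Theory Num.Theory.
Import numFieldNormedType.Exports.
Local Open Scope classical_set_scope.
Local Open Scope ring_scope.

(* A vertex is the list of the subtrees hanging from its offspring.  The
   embedding is forgotten below, by passing to isomorphism classes. *)
Inductive plane_tree := Node of seq plane_tree.

Definition offspring (t : plane_tree) : seq plane_tree := let: Node s := t in s.

Lemma plane_tree_ind2 (P : plane_tree -> Prop) :
  (forall s, List.Forall P s -> P (Node s)) -> forall t, P t.
Proof.
move=> H; fix IH 1 => -[s]; apply: H.
by elim: s => [|t s IHs]; constructor.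
Qed.

Fixpoint plane_tree_encode (t : plane_tree) : GenTree.tree nat :=
  let: Node s := t in GenTree.Node 0 [seq plane_tree_encode u | u <- s].
Fixpoint plane_tree_decode (t : GenTree.tree nat) : plane_tree :=
  if t is GenTree.Node _ s then Node [seq plane_tree_decode u | u <- s]
  else Node [::].

Lemma plane_tree_encodeK : cancel plane_tree_encode plane_tree_decode.
Proof.
elim/plane_tree_ind2 => s IH /=; congr Node.
by elim: IH => //= t s' -> _ ->.
Qed.

HB.instance Definition _ := Countable.copy plane_tree
  (can_type plane_tree_encodeK).

(* Isomorphism of rooted trees: up to the order of offspring at each vertex. *)
Inductive iso : plane_tree -> plane_tree -> Prop :=
| Iso s t u : perm_eq s t -> List.Forall2 iso t u -> iso (Node s) (Node u).

Lemma Forall2_perm (A : eqType) (P : A -> A -> Prop) (s t t' : seq A) :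
  List.Forall2 P s t -> perm_eq t t' ->
  exists2 s', perm_eq s s' & List.Forall2 P s' t'.
Proof.
elim: t' s t => [|x t' IH] s t st.
  by move=> /perm_nilP t0; move: st; rewrite t0; exists s.
move=> tt'; have : x \in t by rewrite (perm_mem tt') mem_head.
move=> xt; move: st tt'; case/path.splitPr: xt => t1 t2 st tt'.
have [s1 [s2' [st1 [st2 ->]]]] := List.Forall2_app_inv_r _ _ st.
case: s2' st2 => [|y s2] st2; first by inversion st2.
have [yx st2'] : P y x /\ List.Forall2 P s2 t2 by inversion st2.
have tt'' : perm_eq (t1 ++ t2) t'.
  by rewrite -(perm_cons x) -(permPr tt') perm_sym -cat1s perm_catCA.
have [s' ss' s't'] := IH _ _ (List.Forall2_app st1 st2') tt''.
exists (y :: s'); last by constructor.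
apply: (@perm_trans _ (y :: (s1 ++ s2))); last by rewrite perm_cons.
by rewrite -[y :: s2]cat1s perm_catCA.
Qed.


Lemma Forall_perm (A : eqType) (P : A -> Prop) (s t : seq A) :
  List.Forall P s -> perm_eq s t -> List.Forall P t.
Proof.
have allE r : List.Forall P r <-> all (fun x => `[< P x >]) r.
  elim: r => [|x r IH] /=; first by split=> // _; constructor.
  split=> [H|/andP[/asboolP Px /IH Pr]]; last by constructor.
  by inversion H; apply/andP; split; [exact/asboolP|exact/IH].
by move=> /allE Ps st; apply/allE; rewrite -(perm_all _ st).
Qed.

Lemma Forall2_diag (A : Type) (P : A -> A -> Prop) (s : seq A) :
  List.Forall (fun x => P x x) s -> List.Forall2 P s s.
Proof. by elim=> [|x t Px _ IH]; constructor. Qed.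

Lemma iso_refl t : iso t t.
Proof.
elim/plane_tree_ind2: t => s IH.
by apply: (Iso (perm_refl s)); exact: Forall2_diag.
Qed.

Lemma iso_sym t u : iso t u -> iso u t.
Proof.
elim/plane_tree_ind2: t u => s IH u ;case E: _ _ / => [s0 t v st tv].
case: E st => <- st.
have vt : List.Forall2 iso v t.
  have {}IH : List.Forall (fun t => forall u, iso t u -> iso u t) t.
    exact: Forall_perm IH st.
  move: IH; elim: tv => // x y t' v' xy _ IHt' H.
  by inversion H; constructor; auto.
have ts : perm_eq t s by rewrite perm_sym.
have [v' vv' v's] := Forall2_perm vt ts.
exact: Iso vv' v's.
Qed.

Lemma iso_trans t u v : iso t u -> iso u v -> iso t v.
Proof.
elim/plane_tree_ind2: t u v => s IH u v.
case E: _ _ / => [s0 t u0 st tu]; case: E st => <- st.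
case E: _ _ / => [u1 u2 v0 u12 uv]; case: E u12 => <- u12.
have [t' tt' t'u2] := Forall2_perm tu u12.
have st' := perm_trans st tt'.
apply: (Iso st').
have {IH} : List.Forall (fun t => forall u v, iso t u -> iso u v -> iso t v) t'.
  exact: Forall_perm IH st'.
elim: t'u2 v0 uv => [|x y t1 u3 xy _ IHt] v0 uv H.
  by inversion uv; constructor.
inversion uv; inversion H; subst; constructor; eauto.
Qed.

(* A non-root vertex has degree 2 iff it has exactly one offspring. *)
Fixpoint no_unary (t : plane_tree) : bool :=
  let: Node s := t in (size s != 1)%N && all no_unary s.

Definition planted (t : plane_tree) : bool := (size (offspring t) <= 1)%N.

Definition reduced (t : plane_tree) : bool := all no_unary (offspring t).

Definition plane_planted : Type := {t : plane_tree | planted t && reduced t}.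
HB.instance Definition _ := Countable.on plane_planted.

Definition planted_iso (t u : plane_planted) : bool := `[< iso (val t) (val u) >].

Lemma planted_iso_refl : reflexive planted_iso.
Proof. by move=> t; apply/asboolP; exact: iso_refl. Qed.

Lemma planted_iso_sym : symmetric planted_iso.
Proof. by move=> t u; apply/asboolP/asboolP; exact: iso_sym. Qed.

Lemma planted_iso_trans : transitive planted_iso.
Proof.
by move=> u t v /asboolP tu /asboolP uv; apply/asboolP; exact: iso_trans tu uv.
Qed.

Canonical planted_iso_equiv :=
  EquivRel planted_iso planted_iso_refl planted_iso_sym planted_iso_trans.

Definition tree : Type := {eq_quot planted_iso}%qT.
HB.instance Definition _ := Choice.on tree.
HB.instance Definition _ := EqQuotient.on tree.

Definition plane_phi : plane_planted := exist _ (Node [::]) isT.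
Definition phi : tree := (\pi_tree plane_phi)%qT.

HB.instance Definition _ := isPointed.Build tree phi.
HB.instance Definition _ := @isMeasurable.Build default_measure_display
  tree discrete_measurable discrete_measurable0
  discrete_measurableC discrete_measurableU.

(* A leaf is a non-root vertex without offspring, so the vertex at the top of
   [t] is kept whatever its number of offspring. *)
Fixpoint drop_leaves (t : plane_tree) : plane_tree :=
  let: Node s := t in
  Node (pmap (fun u => if u is Node [::] then None else Some (drop_leaves u)) s).

Fixpoint suppress_unary (t : plane_tree) : plane_tree :=
  let: Node s := t in
  let s' := [seq suppress_unary u | u <- s] in
  if s' is [:: u] then u else Node s'.

(* The root is never suppressed. *)
Definition series_reduction (t : plane_tree) : plane_tree :=
  Node [seq suppress_unary u | u <- offspring t].

Definition plane_horton (t : plane_tree) : plane_tree :=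
  series_reduction (drop_leaves t).

Lemma no_unary_suppress t : no_unary (suppress_unary t).
Proof.
elim/plane_tree_ind2: t => s IH /=.
have: all no_unary [seq suppress_unary u | u <- s].
  by elim: IH => //= u s' -> _ ->.
case: [seq _ | _ <- s] => [|u [|v r]] //=.
by rewrite andbT.
Qed.

Lemma plane_hortonP (t : plane_planted) :
  planted (plane_horton (val t)) && reduced (plane_horton (val t)).
Proof.
case: t => -[s] /= /andP[ps _]; rewrite /planted /reduced /=; apply/andP; split.
  rewrite size_map; apply: leq_trans ps.
  by rewrite size_pmap count_size.
by rewrite all_map; apply/allP => u _ /=; exact: no_unary_suppress.
Qed.

Definition planted_horton (t : plane_planted) : plane_planted :=
  exist _ (plane_horton (val t)) (plane_hortonP t).

(* Independent of the representative: see [hortonE] below. *)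
Definition horton (T : tree) : tree :=
  (\pi_tree (planted_horton (repr T)))%qT.

Lemma iso_inv s u : iso (Node s) (Node u) ->
  exists2 t, perm_eq s t & List.Forall2 iso t u.
Proof. by move=> H; inversion H; subst; exists t. Qed.

Lemma Forall2_impl (A B : Type) (P : A -> A -> Prop) (P' : B -> B -> Prop)
    (f : A -> B) (s u : seq A) :
  List.Forall (fun x => forall y, P x y -> P' (f x) (f y)) s ->
  List.Forall2 P s u -> List.Forall2 P' (map f s) (map f u).
Proof.
move=> + su; elim: su => [|x y s' u' xy _ IH] H; first by constructor.
by inversion H; subst; constructor; auto.
Qed.

Lemma iso_drop_leaves t u : iso t u -> iso (drop_leaves t) (drop_leaves u).
Proof.
elim/plane_tree_ind2: t u => s IH [u] /iso_inv[t st tu] /=.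
apply: Iso (perm_pmap _ st) _.
move: tu (Forall_perm IH st); elim=> [|x y t' u' xy _ IHt] H; first by constructor.
inversion H; subst => /=.
case: x y xy H H2 => -[|x r] [[|y v]] xy H Hx.
- exact: IHt.
- have [r] := iso_inv xy; rewrite perm_sym => /perm_nilP -> rv.
  by inversion rv.
- have [r' xr r'0] := iso_inv xy; move: xr; inversion r'0.
  by move/perm_nilP.
- by constructor; [exact: Hx|exact: IHt].
Qed.

Lemma iso_suppress_unary t u : iso t u ->
  iso (suppress_unary t) (suppress_unary u).
Proof.
elim/plane_tree_ind2: t u => s IH [u] /iso_inv[t st tu] /=.
have := Forall2_impl (Forall_perm IH st) tu.
have := perm_map suppress_unary st.
set a := map _ s; set b := map _ t; set c := map _ u => ab bc.
have Iabc : iso (Node a) (Node c) by exact: Iso ab bc.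
have sab := perm_size ab; have sbc := List.Forall2_length bc.
case: a ab sab Iabc => [|x [|x' a]] ab sab Iabc.
- by case: c bc sbc Iabc => [|y [|y' c]] //; case: b ab sab.
- case: b ab sab bc sbc => [|y [|? ?]] // + _.
  rewrite perm_sym => /perm_small_eq -> // bc; inversion bc; subst.
  by inversion H3.
- by case: c bc sbc Iabc => [|y [|y' c]] //; case: b ab sab => [|? []].
Qed.

Lemma iso_horton t u : iso t u -> iso (plane_horton t) (plane_horton u).
Proof.
move/iso_drop_leaves; rewrite /plane_horton /series_reduction.
case: (drop_leaves t) (drop_leaves u) => s [u'] /iso_inv[v sv vu] /=.
apply: Iso (perm_map _ sv) _; apply: Forall2_impl vu.
by apply/List.Forall_forall => x _ y; exact: iso_suppress_unary.
Qed.

Lemma hortonE (t : plane_planted) :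
  horton (\pi_tree t)%qT = (\pi_tree (planted_horton t))%qT.
Proof.
apply/eqmodP/asboolP; apply: iso_horton.
have /eqmodP/asboolP : repr (\pi_tree t)%qT = t %[mod tree]%qT by rewrite reprK.
by [].
Qed.

Section galton_watson.
Context {R : realType}.
Implicit Types (q : nat -> R) (mu nu : set tree -> \bar R).

Definition offspring_distribution q :=
  [/\ forall k, 0 <= q k, (\sum_(0 <= k <oo) (q k)%:E = 1)%E & q 1%N = 0].

Definition offspring_mean q : \bar R := (\sum_(0 <= k <oo) (k%:R * q k)%:E)%E.

Definition critical q := offspring_mean q = 1%E.

Definition subcritical q := (offspring_mean q < 1)%E.

Fixpoint GW_weight q (t : plane_tree) : R :=
  let: Node s := t in q (size s) * \prod_(w <- [seq GW_weight q u | u <- s]) w.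

(* The probability of a plane tree whose root has a single offspring; a tree
   whose root has another number of offspring has probability 0. *)
Definition GW_mass q (t : plane_planted) : R :=
  if offspring (val t) is [:: u] then GW_weight q u else 0.

(* The law on isomorphism classes: the mass of a class is the total mass of its
   plane embeddings. *)
Definition GW q : set tree -> \bar R := fun A =>
  (\esum_(t in [set t | A (\pi_tree t)%qT]) (GW_mass q t)%:E)%E.

(* [GW leaf_offspring] is the point mass at the tree with a single edge. *)
Definition leaf_offspring : nat -> R := fun k => (k == 0%N)%:R.

(* Only meaningful where the power series converges, e.g. for -1 <= z <= 1 when
   [q] is an offspring distribution. *)
Definition pgf q (z : R) : R := limn (pseries q z).

Definition S_fun q (z : R) : R :=
  (pgf q z - z * (pgf q)^`()%classic z) / (1 - (pgf q)^`()%classic z).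

(* [mu] is the invariant Galton-Watson measure of parameter r in [1/2, 1]. The
   generating function determines p, hence mu, uniquely. *)
Definition is_IGW (r : R) mu : Prop :=
  (1 / 2 <= r < 1 /\
    exists p, [/\ offspring_distribution p, critical p,
      (forall z, 0 <= z < 1 -> pgf p z = z + r * (1 - z) `^ (1 / r)) &
      mu = GW p])
  \/ (r = 1 /\ mu = GW leaf_offspring).

Definition conditional nu (B : set tree) : set tree -> \bar R :=
  fun A => (nu (A `&` B) / nu B)%E.

Definition pruning_step mu : set tree -> \bar R :=
  conditional (pushforward mu horton) [set T | T != phi].

Definition pruned_law mu (k : nat) : set tree -> \bar R := iter k pruning_step mu.

End galton_watson.

(* Main.v *)
Require Import Defs.
From mathcomp Require Import all_boot all_order all_algebra.
From mathcomp Require Import all_classical all_reals all_analysis.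
From mathcomp Require Import ring lra.
Import Order.TTheory GRing.Theory Num.Theory.
Import numFieldNormedType.Exports.
Local Open Scope classical_set_scope.
Local Open Scope ring_scope.

(** Pruning acts on the offspring law, and on its generating function Q it acts
    as a conjugation.  Deleting the leaves of a Galton-Watson tree thins the
    offspring of each vertex (an offspring is lost with probability q_0), and
    series reduction conditions the thinned number of offspring on being
    different from 1.  Since the subtrees of distinct offspring are independent,
    a tree conditioned on being nonempty after pruning is again a Galton-Watson
    tree, with offspring law [prune q]: this is [pruning_step_GW].  Its core is
    [fiber_weight_prune], which computes the total weight of the plane trees
    pruned to a given plane tree v by induction on v: the top vertex of such a
    tree either keeps as many offspring as v has, or keeps a single one and is
    then suppressed, so that the unknown weight solves a linear equation.
    Dividing by the probability 1 - q_0 of surviving is legitimate because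
    a (sub)critical tree is finite almost surely ([GW_weight_total]).

    Write g(t) = Q(1 - t) - (1 - t) ([gap] below).  The formula for the
    generating function of [prune q] says that g is replaced by
      t |-> g(s t) / (s g'(s)),  where s = 1 - q_0,
    so after k steps one sees g(a_k t) / (a_k g'(a_k)) with a_0 = 1 and
      a_{k+1} = a_k - g(a_k) / g'(a_k)
    ([gap_iter_prune]).  Thus 1 - a_k are the Newton iterates, that is the
    iterates of S, for the equation Q(x) = x started at 0, and a_k decreases
    to 0 because g is positive and nondecreasing ([newton_cvg0]).  The iterated
    pruning is a zoom on the graph of Q at the fixed point 1.

    In terms of g the existence of S'(1) = L says that g(t) / (t g'(t)) tends
    to r = 1 - L as t tends to 0.  Convexity of g and, in the critical case,
    concavity of g' with g'(0) = 0 give 1/2 <= r <= 1.  The logarithmic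
    derivative of g is then asymptotic to 1 / (r t), hence g(c t) / g(t) tends
    to c^(1/r) ([gap_regular_variation]), and the generating functions of the
    pruned laws tend to z + r (1 - z)^(1/r) on [0, 1[.  Pointwise convergence of
    generating functions forces convergence of each offspring probability
    ([pgf_continuity]), and the mass of an isomorphism class of trees is
    a polynomial in finitely many of these ([cvg_GW]).  When r < 1 the limits
    form the critical law of IGW(r) ([IGW_offspring]).  When r = 1, and also in
    the subcritical case, where g(t) / (t g'(t)) tends to 1 because
    g'(0) = 1 - mean is positive ([subcritical_ratio_cvg]), the probability of
    having no offspring tends to 1, which gives the point mass at the single
    edge. *)

Set Implicit Arguments.
Unset Strict Implicit.
Unset Printing Implicit Defensive.

(** * Convergent real series *)

Section sums.
Context {R : realType}.
Implicit Types (a b : nat -> R) (l : R).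

Definition sums a l := series a @ \oo --> l.

Lemma sums_lim a l : sums a l -> limn (series a) = l.
Proof. by move=> /cvg_lim; exact. Qed.

Lemma sums_cvg a : cvgn (series a) -> sums a (limn (series a)).
Proof. by []. Qed.

Lemma sums_uniq a l l' : sums a l -> sums a l' -> l = l'.
Proof. by move=> /sums_lim <- /sums_lim <-. Qed.

Lemma eq_sums a b l : (forall k, a k = b k) -> sums a l -> sums b l.
Proof. by move=> /funext ->. Qed.

Lemma sumsD a b l l' : sums a l -> sums b l' -> sums (fun k => a k + b k) (l + l').
Proof. by move=> al bl; rewrite /sums (_ : (fun k => _) = a + b :> (nat -> R)) // seriesD; exact: cvgD. Qed.

Lemma sumsB a b l l' : sums a l -> sums b l' -> sums (fun k => a k - b k) (l - l').
Proof.
move=> al bl; rewrite /sums (_ : (fun k => _) = a + - b :> (nat -> R)) // seriesD seriesN.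
exact: cvgB.
Qed.

Lemma sumsZ c a l : sums a l -> sums (fun k => c * a k) (c * l).
Proof.
move=> al; rewrite /sums (_ : (fun k => _) = c *: a :> (nat -> R)) // seriesZ.
exact: cvgZl_tmp.
Qed.

Lemma ge0_sums_ge a l n : (forall k, 0 <= a k) -> sums a l -> series a n <= l.
Proof.
move=> a0 al; rewrite -(sums_lim al); apply: nondecreasing_cvgn_le.
  exact: nondecreasing_series.
by apply/cvg_ex; exists l.
Qed.

Lemma sums_term_le a l n : (forall k, 0 <= a k) -> sums a l -> a n <= l.
Proof.
move=> a0 /(ge0_sums_ge n.+1 a0); apply: le_trans.
by rewrite seriesSr lerDr sumr_ge0.
Qed.

Lemma sums_ge0 a l : (forall k, 0 <= a k) -> sums a l -> 0 <= l.
Proof. by move=> a0 al; exact: le_trans (a0 0) (sums_term_le _ _ al). Qed.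

Lemma ler_sums a b l l' : (forall k, a k <= b k) -> sums a l -> sums b l' -> l <= l'.
Proof.
move=> ab al bl; rewrite -subr_ge0; apply: sums_ge0 (sumsB bl al) => k.
by rewrite subr_ge0.
Qed.

Lemma sums_le a l c : sums a l -> (forall n, series a n <= c) -> l <= c.
Proof. by move=> al ac; apply: cvgr_to_le al _; exact: nearW. Qed.

Lemma sums_bounded a c : (forall k, 0 <= a k) -> (forall n, series a n <= c) ->
  exists2 l, sums a l & 0 <= l <= c.
Proof.
move=> a0 ac; have cva : cvgn (series a).
  apply: nondecreasing_is_cvgn; first exact: nondecreasing_series.
  by exists c => _ [n _ <-].
exists (limn (series a)); first exact: sums_cvg.
by rewrite (sums_ge0 a0) //= (sums_le (sums_cvg cva)).
Qed.

Lemma sums_dom a b l : (forall k, 0 <= a k <= b k) -> sums b l ->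
  exists2 l', sums a l' & 0 <= l' <= l.
Proof.
move=> ab bl; have a0 k : 0 <= a k by case/andP: (ab k).
apply: sums_bounded => // n; apply: le_trans (ge0_sums_ge n _ bl).
  by apply: ler_sum => k _; case/andP: (ab k).
by move=> k; case/andP: (ab k) => /le_trans; apply.
Qed.

Lemma sums_tail a l : sums a l -> sums (fun k => a k.+1) (l - a 0).
Proof.
move=> al; rewrite /sums.
rewrite (_ : series _ = (fun n => series a n.+1 - a 0)).
  by apply: cvgB; [rewrite cvg_shiftS|exact: cvg_cst].
by apply/funext => n; rewrite /series /= big_nat_recl // addrC addKr.
Qed.

(** Passage to the extended-real series in which the hypotheses on offspring
    laws are stated. *)
Lemma ge0_sumsP a l : (forall k, 0 <= a k) ->
  sums a l <-> (\sum_(0 <= k <oo) (a k)%:E = l%:E)%E.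
Proof.
have E b c : sums b c -> (\sum_(0 <= k <oo) (b k)%:E = c%:E)%E.
  move=> bc; apply/cvg_lim => //.
  rewrite (_ : (fun n => _) = EFin \o series b); first exact/cvg_EFin/bc/nearW.
  by apply/funext => n /=; rewrite sumEFin.
move=> a0; split => [/E//|al].
have /sums_cvg/[dup]/E : cvgn (series a).
  by apply: nnseries_is_cvg => //; rewrite al ltry.
by rewrite al => -[->].
Qed.

Lemma sums1 a n : (forall k, k != n -> a k = 0) -> sums a (a n).
Proof.
move=> a0; rewrite /sums; apply: (@cvg_near_cst _ _ _ _ _ _ _).
exists n.+1 => // m /= nm; rewrite /series /= (big_cat_nat (n := n.+1)) //=.
rewrite big_nat_recr //= big1_seq ?add0r => [|i]; last first.
  by rewrite mem_index_iota => /andP[_] /andP[_ /ltn_eqF/negbT/a0].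
rewrite big1_seq ?addr0 // => i; rewrite mem_index_iota => /andP[_] /andP[ni _].
by apply: a0; rewrite gtn_eqF.
Qed.

End sums.

Arguments sumsZ {R} c {a l}.

(** * Sums over words and over plane trees *)

Section esum_extra.
Context {R : realType}.

(** Summation along the fibers of h; applied below to the pruning map. *)
Lemma esum_fiber (T T' : choiceType) (P : set T) (A : set T') (h : T -> T')
    (F : T -> \bar R) : (forall x, 0 <= F x)%E ->
  (\esum_(u in P `&` h @^-1` A) F u =
   \esum_(v in A) \esum_(u in P `&` h @^-1` [set v]) F u)%E.
Proof.
move=> F0; rewrite (@esum_esum R T' T A (fun v => P `&` h @^-1` [set v]) (fun=> F)) //.
rewrite (@reindex_esum R _ _ (P `&` h @^-1` A) _ (fun u => (h u, u))) //.
split=> [u [Pu Au]|u v _ _ []|[v u] /= [Av [Pu hu]]] //.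
by exists u => /=; rewrite ?hu //; split=> //; rewrite /preimage/= hu.
Qed.

Lemma esumZl (T : choiceType) (P : set T) (c : R) (F : T -> \bar R) :
    0 <= c -> (forall x, 0 <= F x)%E ->
  (\esum_(u in P) (c%:E * F u) = c%:E * \esum_(u in P) F u)%E.
Proof.
move=> c0 F0; rewrite /esum -ereal_supZl //; last first.
  by apply/set0P; exists 0%E; exists set0; [split|rewrite fsbig_set0].
congr ereal_sup; apply/seteqP; split=> y /=.
  by move=> [X PX <-]; exists (\sum_(x \in X) F x)%E; [exists X|rewrite ge0_mule_fsumr].
by move=> [_ [X PX <-] <-]; exists X; rewrite // ge0_mule_fsumr.
Qed.

Definition words {T : Type} (k : nat) : set (seq T) := [set s | size s = k].

Lemma esum_words0 (T : choiceType) (F : seq T -> \bar R) :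
  (0 <= F [::] -> \esum_(s in words 0) F s = F [::])%E.
Proof.
move=> F0; rewrite (_ : words 0 = [set [::]]) ?esum_set1 //.
by apply/seteqP; split=> [[]|_ ->].
Qed.

Lemma esum_wordsS (T : choiceType) k (F : seq T -> \bar R) :
    (forall s, 0 <= F s)%E ->
  (\esum_(s in words k.+1) F s =
   \esum_(u in [set: T]) \esum_(s in words k) F (u :: s))%E.
Proof.
move=> F0; rewrite (@esum_esum R T _ _ (fun=> words k) (fun u s => F (u :: s))) //.
rewrite (@reindex_esum R _ _ (setT `*`` (fun=> words k)) _ (fun u => u.1 :: u.2)) //.
split=> [[u s] [_ /= sk]|[u s] [v t] _ _ /= [-> ->]|[//|u s] /= [sk]] //=.
  by rewrite /words/= sk.
by exists (u, s).
Qed.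

(** Independence of the letters of a word of fixed length. *)
Lemma esum_prod_words (T : choiceType) (f : T -> R) (m : R) k :
    (forall x, 0 <= f x) -> (\esum_(x in setT) (f x)%:E = m%:E)%E ->
  (\esum_(s in words k) (\prod_(x <- s) f x)%:E = (m ^+ k)%:E)%E.
Proof.
move=> f0 fm; have m0 : 0 <= m by rewrite -lee_fin -fm; apply: esum_ge0 => *; rewrite lee_fin.
have P0 s : (0 <= (\prod_(x <- s) f x)%:E)%E by rewrite lee_fin prodr_ge0.
elim: k => [|k IH]; first by rewrite esum_words0 // big_nil.
rewrite esum_wordsS //.
under eq_esum => u _.
  under eq_esum do rewrite big_cons EFinM.
  rewrite esumZl // IH muleC; over.
by rewrite /= esumZl ?exprn_ge0 // ?fm -?EFinM ?exprSr // => x; rewrite lee_fin.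
Qed.

End esum_extra.

Section tree_sums.
Context {R : realType}.
Implicit Types (q : nat -> R).

Lemma esum_plane_tree (F : plane_tree -> \bar R) : (forall t, 0 <= F t)%E ->
  (\esum_(t in setT) F t =
   \sum_(0 <= k <oo) \esum_(s in words k) F (Node s))%E.
Proof.
move=> F0; rewrite nneseries_esumT; last by move=> k; apply: esum_ge0.
rewrite (@esum_esum R nat _ _ (fun k => words k) (fun=> F \o Node)) //=.
rewrite (@reindex_esum R _ _ (setT `*`` words) _ (fun u => Node u.2)) //.
split=> [//|[j s] [k t]|[s] _].
  by rewrite !inE /= => -[_ <-] [_ <-] [->].
by exists (size s, s).
Qed.

(** The branching property: the subtrees at the top vertex of a Galton-Watson
    tree are independent copies of it. *)
Lemma esum_node (c : nat -> R) (f : plane_tree -> R) (m : R) :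
    (forall k, 0 <= c k) -> (forall x, 0 <= f x) ->
    (\esum_(x in setT) (f x)%:E = m%:E)%E ->
  (\esum_(t in setT)
     (c (size (offspring t)) * \prod_(x <- offspring t) f x)%:E =
   \sum_(0 <= k <oo) (c k * m ^+ k)%:E)%E.
Proof.
move=> c0 f0 fm; rewrite esum_plane_tree; last first.
  by move=> t; rewrite lee_fin mulr_ge0 // prodr_ge0.
apply: eq_eseriesr => k _ /=.
transitivity (\esum_(s in words k) ((c k)%:E * (\prod_(x <- s) f x)%:E))%E.
  by apply: eq_esum => s <-; rewrite EFinM.
rewrite esumZl // => [|s]; last by rewrite lee_fin prodr_ge0.
by rewrite (esum_prod_words _ f0 fm) EFinM.
Qed.

Lemma GW_weight_ge0 q t : (forall k, 0 <= q k) -> 0 <= GW_weight q t.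
Proof.
move=> q0; elim/plane_tree_ind2: t => s IH /=; rewrite mulr_ge0 //.
elim: IH => [|t s' t0 _ IH]; first by rewrite big_nil.
by rewrite /= big_cons mulr_ge0.
Qed.

Lemma GW_weightE q t :
  GW_weight q t = q (size (offspring t)) * \prod_(u <- offspring t) GW_weight q u.
Proof. by case: t => s /=; rewrite big_map. Qed.

(** The weight of a tree, put to 0 when the tree has height at least h.  The
    total weight is not known to be finite a priori, whereas the truncated
    totals are bounded by induction on h. *)
Fixpoint cut_weight q h t : R :=
  if h is h'.+1 then
    q (size (offspring t)) * \prod_(u <- offspring t) cut_weight q h' u
  else 0.

Lemma cut_weight_ge0 q h t : (forall k, 0 <= q k) -> 0 <= cut_weight q h t.
Proof. by move=> q0; elim: h t => [|h IH] t //=; rewrite mulr_ge0 ?prodr_ge0. Qed.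

Lemma cut_weight_eventually q t :
  exists n, forall h, (n <= h)%N -> cut_weight q h t = GW_weight q t.
Proof.
elim/plane_tree_ind2: t => s IH.
suff [n Hn] : exists n, forall h, (n <= h)%N ->
    \prod_(u <- s) cut_weight q h u = \prod_(u <- s) GW_weight q u.
  by exists n.+1 => -[|h] // nh; rewrite GW_weightE /= Hn.
elim: IH => [|t s' [n1 H1] _ [n2 H2]]; first by exists 0 => h _; rewrite !big_nil.
exists (maxn n1 n2) => h; rewrite geq_max => /andP[h1 h2].
by rewrite !big_cons H1 // H2.
Qed.

Lemma cut_weight_le1 q h : offspring_distribution q ->
  (\esum_(t in setT) (cut_weight q h t)%:E <= 1)%E.
Proof.
move=> [q0 q1 _]; elim: h => [|h IH]; first by rewrite esum1.
have cw0 t : (0 <= (cut_weight q h t)%:E)%E by rewrite lee_fin cut_weight_ge0.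
have S0 : (0 <= \esum_(t in setT) (cut_weight q h t)%:E)%E by exact: esum_ge0.
have [m Hm] : exists m, \esum_(t in setT) (cut_weight q h t)%:E = m%:E.
  exists (fine (\esum_(t in setT) (cut_weight q h t)%:E)%E); rewrite fineK //.
  by rewrite ge0_fin_numE // (le_lt_trans IH) // ltry.
have [m0 m1] : 0 <= m /\ m <= 1 by rewrite -!lee_fin -Hm.
rewrite /= (esum_node q0 (fun x => cut_weight_ge0 h x q0) Hm).
rewrite -q1; apply: lee_nneseries => k _.
  by rewrite lee_fin mulr_ge0 // exprn_ge0.
by rewrite lee_fin ler_piMr // exprn_ile1.
Qed.

(** Only finitely many trees enter a partial sum, so a common height bounds them
    all and the sum is one of truncated weights. *)
Lemma GW_weight_le1 q : offspring_distribution q ->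
  (\esum_(t in setT) (GW_weight q t)%:E <= 1)%E.
Proof.
move=> hq; have [q0 _ _] := hq; apply: ge_ereal_sup => _ [X [finX _] <-].
have eventually_seq (s : seq plane_tree) : exists n, forall h, (n <= h)%N ->
    {in s, forall t, cut_weight q h t = GW_weight q t}.
  elim: s => [|t s [n1 H1]]; first by exists 0.
  have [n2 H2] := cut_weight_eventually q t.
  exists (maxn n1 n2) => h; rewrite geq_max => /andP[h1 h2] u.
  by rewrite inE => /orP[/eqP ->|]; [exact: H2|exact: H1].
rewrite fsbig_finite //=; set s : seq plane_tree := (X in bigop _ X _).
have [n Hn] := eventually_seq s.
apply: le_trans (cut_weight_le1 n hq).
apply: esum_ge; exists X => //; rewrite fsbig_finite //= -/s.
rewrite big_seq [leRHS]big_seq.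
by apply: lee_sum => t ts; rewrite Hn.

Qed.

(** The probability m of extinction solves Q(m) = m. *)
Lemma GW_weight_fixpoint q : offspring_distribution q ->
  exists m : R, [/\ 0 <= m <= 1, (\esum_(t in setT) (GW_weight q t)%:E = m%:E)%E &
    m%:E = (\sum_(0 <= k <oo) (q k * m ^+ k)%:E)%E].
Proof.
move=> hq; have [q0 _ _] := hq.
have S0 : (0 <= \esum_(t in setT) (GW_weight q t)%:E)%E.
  by apply: esum_ge0 => t _; rewrite lee_fin GW_weight_ge0.
have S1 := GW_weight_le1 hq.
have [m Hm] : exists m, \esum_(t in setT) (GW_weight q t)%:E = m%:E.
  exists (fine (\esum_(t in setT) (GW_weight q t)%:E)%E); rewrite fineK //.
  by rewrite ge0_fin_numE // (le_lt_trans S1) // ltry.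
exists m; split => //; first by rewrite -!lee_fin -Hm S0.
rewrite -(esum_node q0 (fun x => GW_weight_ge0 x q0) Hm).
by rewrite -Hm; apply: eq_esum => t _; rewrite [in LHS]GW_weightE.
Qed.

End tree_sums.

(** * Inequalities between powers *)

Section power_inequalities.
Context {R : realType}.
Implicit Types x y : R.

(** These bounds are the convexity of the powers, written without derivatives;
    summed against an offspring law they become the bounds on its generating
    function used below. *)
Lemma exprB_ge x y n : 0 <= x <= y ->
  n.+1%:R * x ^+ n * (y - x) <= y ^+ n.+1 - x ^+ n.+1.
Proof.
move=> /andP[x0 xy]; elim: n => [|n IH]; first by rewrite expr0 !expr1 !mul1r.
have xyn : x ^+ n.+1 <= y ^+ n.+1 by rewrite lerXn2r ?nnegrE // (le_trans x0).
have := ler_wpM2l x0 IH; rewrite -natr1 !exprS in xyn *; nra.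
Qed.

Lemma exprB_gt x n : 0 <= x < 1 ->
  n.+2%:R * x ^+ n.+1 * (1 - x) < 1 - x ^+ n.+2.
Proof.
move=> /andP[x0 x1]; have := @exprB_ge x 1 n; rewrite x0 (ltW x1) expr1n => /(_ isT).
have xn : x ^+ n.+1 < 1 by rewrite exprn_ilt1.
move=> /(ler_wpM2l x0); rewrite -[n.+2%:R]natr1 !exprS in xn *; nra.
Qed.

Lemma exprB_le x y n : 0 <= x <= y -> y <= 1 -> y ^+ n - x ^+ n <= n%:R * (y - x).
Proof.
move=> /andP[x0 xy] y1; elim: n => [|n IH]; first by rewrite !expr0 subrr mul0r.
have yn : 0 <= y ^+ n <= 1 by rewrite exprn_ge0 ?exprn_ile1 // (le_trans x0).
rewrite !exprS -natr1; case/andP: yn => yn0 yn1.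
have := ler_wpM2l x0 IH.
have : 0 <= n%:R * (1 - x) * (y - x) by rewrite !mulr_ge0 // subr_ge0 // (le_trans xy).
nra.
Qed.

Lemma bernoulli_lt x n : 0 <= x < 1 -> 1 - x ^+ n.+2 < n.+2%:R * (1 - x).
Proof.
move=> /andP[x0 x1]; have := @exprB_le x 1 n.+1; rewrite x0 (ltW x1) expr1n.
move=> /(_ isT (lexx _)) /(ler_wpM2l x0); rewrite -[n.+2%:R]natr1 [x ^+ n.+2]exprS.
have : 0 < n.+1%:R * (1 - x) * (1 - x) by rewrite !mulr_gt0 // subr_gt0.
nra.
Qed.

(** The trapezoid rule overestimates the integral from x to 1 of the convex
    function (n + 1) s^n; this is where the exponent 1/r is bounded by 2. *)
Lemma expr_trapezoid x n : 0 <= x <= 1 ->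
  2 * (1 - x ^+ n.+1) <= n.+1%:R * (1 - x) * (1 + x ^+ n).
Proof.
move=> /andP[x0 x1]; elim: n => [|n IH]; first by rewrite expr0 expr1; nra.
have := @exprB_ge x 1 n; rewrite x0 x1 expr1n => /(_ isT) H.
have x1' : 0 <= 1 - x by lra.
have := ler_wpM2l x1' H.
move: IH; rewrite -[n.+2%:R]natr1 !exprS; nra.
Qed.

End power_inequalities.

(** * Generating functions of (sub)critical laws *)

Section pgf.
Context {R : realType}.
Implicit Types (q : nat -> R) (x t : R).

(** Critical or subcritical; the trees are then almost surely finite.  This is
    the class of laws preserved by pruning. *)
Definition subcritical_offspring q :=
  [/\ offspring_distribution q, q 0%N < 1 & (offspring_mean q <= 1)%E].

(** The derivative of the generating function, as a series that still makes
    sense at the endpoint 1. *)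
Definition dpgf q x : R := limn (series (fun k => k%:R * q k * x ^+ k.-1)).

(** Comparison k x^(k-1) (y - x) <= y^k. *)
Lemma is_cvg_pseries_diffs q x y : (forall k, 0 <= q k) -> 0 <= x < y ->
  cvgn (pseries q y) -> cvgn (pseries (pseries_diffs q) x).
Proof.
move=> q0 /andP[x0 xy] /sums_cvg/sums_tail/(sumsZ (y - x)^-1) qy.
have yx : 0 < y - x by rewrite subr_gt0.
have y0 : 0 <= y by rewrite (le_trans x0 (ltW xy)).
have [k|l ? _] := @sums_dom _ (fun k => pseries_diffs q k * x ^+ k) _ _ _ qy; last first.
  by apply/cvg_ex; exists l.
rewrite /pseries_diffs !mulr_ge0 ?exprn_ge0 //= [leRHS]mulrC ler_pdivlMr //.
rewrite [leLHS](_ : _ = q k.+1 * (k.+1%:R * x ^+ k * (y - x))); last ring.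
rewrite ler_wpM2l //.
have := @exprB_ge _ x y k; rewrite x0 (ltW xy) => /(_ isT) /le_trans; apply.
by rewrite gerBl exprn_ge0.
Qed.

Section fixed.
Variable q : nat -> R.
Hypothesis hq : subcritical_offspring q.

Let q_ge0 k : 0 <= q k. Proof. by case: hq => -[]. Qed.
Let q_1 : q 1 = 0. Proof. by case: hq => -[]. Qed.

Lemma offspring_sums : sums q 1.
Proof. by apply/ge0_sumsP => //; case: hq => -[]. Qed.

Lemma offspring_mean_sums :
  exists m, [/\ sums (fun k => k%:R * q k) m, 0 <= m <= 1 & offspring_mean q = m%:E].
Proof.
have k0 k : 0 <= k%:R * q k by rewrite mulr_ge0.
have m0 : (0 <= offspring_mean q)%E by apply: nneseries_ge0 => *; rewrite lee_fin.
have m1 : (offspring_mean q <= 1)%E by case: hq.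
have [m Hm] : exists m, offspring_mean q = m%:E.
  exists (fine (offspring_mean q)); rewrite fineK // ge0_fin_numE //.
  by rewrite (le_lt_trans m1) // ltry.
by exists m; split=> //; [exact/ge0_sumsP|rewrite -!lee_fin -Hm m0].
Qed.

Lemma offspring_two : exists k, 0 < q k.+2.
Proof.
apply: contrapT => /forallNP q2.
suff : q 0 = 1 by case: hq => _ + _ q01; rewrite q01 ltxx.
apply: (sums_uniq (@sums1 _ q 0 _) offspring_sums) => -[|[|k]] // _.
by have := q_ge0 k.+2; rewrite le_eqVlt => /orP[/eqP <-//|/q2].
Qed.

Lemma pgf_sums x : 0 <= x <= 1 -> sums (fun k => q k * x ^+ k) (pgf q x).
Proof.
move=> /andP[x0 x1]; have [k|l l1 _] := @sums_dom _ (fun k => q k * x ^+ k) _ _ _ offspring_sums.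
  by rewrite mulr_ge0 ?exprn_ge0 //= ler_piMr // exprn_ile1.
by rewrite /pgf /pseries (sums_lim l1).
Qed.

Lemma dpgf_sums x : 0 <= x <= 1 -> sums (fun k => k%:R * q k * x ^+ k.-1) (dpgf q x).
Proof.
move=> /andP[x0 x1]; have [m [mS _ _]] := offspring_mean_sums.
have [k|l l1 _] := @sums_dom _ (fun k => k%:R * q k * x ^+ k.-1) _ _ _ mS.
  by rewrite !mulr_ge0 ?exprn_ge0 //= ler_piMr ?exprn_ile1 // mulr_ge0.
by rewrite /dpgf (sums_lim l1).
Qed.

Lemma pgf1 : pgf q 1 = 1.
Proof.
apply: sums_uniq offspring_sums; apply: eq_sums (pgf_sums _) => [k|].
  by rewrite expr1n mulr1.
by rewrite ler01 lexx.
Qed.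

Lemma pgf0 : pgf q 0 = q 0.
Proof.
have /pgf_sums H : 0 <= (0 : R) <= 1 by lra.
apply: sums_uniq H _; rewrite -[X in sums _ X]mulr1 -[X in sums _ (_ * X)](expr0 0).
by apply: (@sums1 _ (fun k => q k * 0 ^+ k)) => -[|k] // _; rewrite expr0n mulr0.
Qed.

Lemma is_derive_pgf x : 0 <= x < 1 -> is_derive x 1 (pgf q) (dpgf q x).
Proof.
move=> /andP[x0 x1].
(* The termwise differentiation theorem asks for two derivatives to converge at
   a point y beyond x; the mean gives the first one up to 1, and each further
   derivative costs some room, hence a second point z. *)
pose y := (1 + x) / 2; pose z := (1 + y) / 2.
have [xy yz z1] : [/\ x < y, y < z & z < 1] by rewrite /z /y; split; lra.
have cdiff : cvgn (pseries (pseries_diffs q) z).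
  apply: is_cvg_pseries_diffs (z) 1 _ _ _ => //; first by rewrite z1 andbT; lra.
  have /pgf_sums H : 0 <= (1 : R) <= 1 by rewrite lexx ler01.
  by apply/cvg_ex; eexists; exact: H.
have cdiffy : cvgn (pseries (pseries_diffs q) y).
  by apply: is_cvg_pseries_inside cdiff _; rewrite !ger0_norm; lra.
suff -> : dpgf q x = limn (pseries (pseries_diffs q) x).
  apply: (@pseries_snd_diffs _ _ y) => //.
  - have /pgf_sums H : 0 <= y <= 1 by lra.
    by apply/cvg_ex; eexists; exact: H.
  - apply: is_cvg_pseries_diffs cdiff => [k|]; last by lra.
    by rewrite mulr_ge0.
  - by rewrite !ger0_norm; lra.
apply: (@sums_lim _ (fun k => k%:R * q k * x ^+ k.-1)).
apply: pseries_diffs_equiv; apply: is_cvg_pseries_inside cdiff _.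
by rewrite !ger0_norm; lra.
Qed.

Lemma S_funE x : 0 <= x < 1 ->
  S_fun q x = (pgf q x - x * dpgf q x) / (1 - dpgf q x).
Proof. by move=> /is_derive_pgf dq; rewrite /S_fun derive1E derive_val. Qed.

(** The height of the graph of Q above the diagonal, seen from its fixed point 1.
    Pruning is a rescaling of this function. *)
Definition gap t := pgf q (1 - t) - (1 - t).
Definition dgap t := 1 - dpgf q (1 - t).

Lemma is_derive_gap t : 0 < t <= 1 -> is_derive t 1 gap (dgap t).
Proof.
move=> t01.
have /is_derive_pgf H : 0 <= 1 - t < 1 by lra.
have H1 : is_derive t 1 (fun t : R => 1 - t) (- 1).
  rewrite -[- 1]add0r; apply: is_deriveB.
have H2 : is_derive t 1 (fun t => pgf q (1 - t)) (dpgf q (1 - t) *: - 1).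
  exact: is_derive1_comp.
have D : is_derive t 1 gap _ := is_deriveB H2 H1.
apply: (is_derive_eq D).
by rewrite /dgap scalerN [_ *: _]mulr1; ring.
Qed.

(** Strict convexity: some q_k with k >= 2 is positive, and Q lies strictly above
    its tangent at 1, whose slope is the mean, at most 1.  In particular 1 is the
    only fixed point of Q on [0, 1]. *)
Lemma gap_gt0 t : 0 < t <= 1 -> 0 < gap t.
Proof.
move=> /andP[t0 t1]; have [m [mS /andP[m0 m1] _]] := offspring_mean_sums.
have t01 : 0 <= 1 - t <= 1 by lra.
have := sumsD (sumsB (pgf_sums t01) offspring_sums) (sumsZ t mS).
set a := (fun k => _); set l := (X in sums _ X) => al.
have aE k : a k = q k * (k%:R * (1 - (1 - t)) - (1 - (1 - t) ^+ k)) by rewrite /a; ring.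
have a0 k : 0 <= a k.
  rewrite aE mulr_ge0 // subr_ge0.
  by have := @exprB_le _ (1 - t) 1 k; rewrite t01 expr1n lexx; apply.
have [n qn] := offspring_two.
have : 0 < a n.+2 by rewrite aE mulr_gt0 // subr_gt0 bernoulli_lt //; lra.
move=> /lt_le_trans /(_ (sums_term_le _ a0 al)); rewrite /l /gap; nra.
Qed.

Lemma le_gap s t : 0 <= s <= t -> t <= 1 -> gap s <= gap t.
Proof.
move=> /andP[s0 st] t1; have [m [mS /andP[m0 m1] _]] := offspring_mean_sums.
have s01 : 0 <= 1 - s <= 1 by lra.
have t01 : 0 <= 1 - t <= 1 by lra.
have := ler_sums _ (sumsB (pgf_sums s01) (pgf_sums t01)) (sumsZ (t - s) mS).
rewrite /gap => H; suff /H : forall k, q k * (1 - s) ^+ k - q k * (1 - t) ^+ k <=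
  (t - s) * (k%:R * q k) by nra.
move=> k; rewrite -mulrBr mulrCA [_ * q k]mulrC mulrA [_ * q k]mulrC -mulrA ler_wpM2l //.
have := @exprB_le _ (1 - t) (1 - s) k; rewrite (_ : 1 - s - (1 - t) = t - s); last ring.
by rewrite mulrC; apply; lra.
Qed.

(** Strict convexity again: g vanishes at 0 and lies above its tangent at t.
    This makes Newton's step stay on the same side of the fixed point. *)
Lemma gap_lt t : 0 < t <= 1 -> gap t < t * dgap t.
Proof.
move=> /andP[t0 t1].
have t01 : 0 <= 1 - t <= 1 by lra.
have := sumsB (sumsB offspring_sums (pgf_sums t01)) (sumsZ t (dpgf_sums t01)).
set a := (fun k => _); set l := (X in sums _ X) => al.
have aE k : a k = q k * (1 - (1 - t) ^+ k - k%:R * (1 - t) ^+ k.-1 * (1 - (1 - t))).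
  by rewrite /a; ring.
have a0 k : 0 <= a k.
  rewrite aE mulr_ge0 // subr_ge0; case: k => [|k]; first by rewrite expr0; lra.
  by have := @exprB_ge _ (1 - t) 1 k; rewrite t01 expr1n; apply.
have [n qn] := offspring_two.
have : 0 < a n.+2 by rewrite aE mulr_gt0 // subr_gt0 exprB_gt //; lra.
move=> /lt_le_trans /(_ (sums_term_le _ a0 al)); rewrite /l /gap /dgap; nra.
Qed.

Lemma dgap_gt0 t : 0 < t <= 1 -> 0 < dgap t.
Proof.
move=> t01; have := gap_lt t01; have := gap_gt0 t01; case/andP: t01 => t0 _.
by move=> /lt_trans H /H; rewrite pmulr_rgt0.
Qed.

Lemma dgap_le1 t : 0 <= t <= 1 -> dgap t <= 1.
Proof.
move=> t01; rewrite /dgap gerBl; apply: sums_ge0 (dpgf_sums _); last by lra.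
by move=> k; rewrite !mulr_ge0 // exprn_ge0 //; lra.
Qed.

(** In the critical case g' is concave and vanishes at 0, so the integral of g'
    over [0, t] is at least the area t g'(t) / 2 of a triangle. *)
Lemma gap_ge_half t : critical q -> 0 < t <= 1 -> t * dgap t <= 2 * gap t.
Proof.
move=> cq /andP[t0 t1]; have [m [mS _ mE]] := offspring_mean_sums.
have {mE} m1 : m = 1 by move: mE; rewrite cq => -[].
rewrite {}m1 in mS.
have t01 : 0 <= 1 - t <= 1 by lra.
have := sumsD (sumsZ t mS) (sumsZ t (dpgf_sums t01)).
have := sumsZ 2 (sumsB offspring_sums (pgf_sums t01)).
move=> H1 H2; have {H1 H2} := ler_sums _ H1 H2; rewrite /gap /dgap => H.
suff /H : forall k, 2 * (q k - q k * (1 - t) ^+ k) <=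
  t * (k%:R * q k) + t * (k%:R * q k * (1 - t) ^+ k.-1) by lra.
move=> k; rewrite [leRHS](_ : _ = q k * (k%:R * t * (1 + (1 - t) ^+ k.-1))); last ring.
rewrite [leLHS](_ : _ = q k * (2 * (1 - (1 - t) ^+ k))); last ring.
rewrite ler_wpM2l //; case: k => [|k]; first by rewrite expr0; lra.
by have := @expr_trapezoid _ (1 - t) k t01; rewrite (_ : 1 - (1 - t) = t); last ring.
Qed.

End fixed.

End pgf.

(** * The offspring law of a pruned tree *)

Section series_extra.
Context {R : realType}.

Lemma sums_interchange (a : nat -> nat -> R) (b c : nat -> R) l :
    (forall k j, 0 <= a k j) -> (forall k, sums (a k) (b k)) ->
    (forall j, sums (a^~ j) (c j)) -> sums b l -> sums c l.
Proof.
move=> a0 ab ac bl.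
have b0 k : 0 <= b k by exact: sums_ge0 (ab k).
have c0 j : 0 <= c j by exact: sums_ge0 (ac j).
apply/ge0_sumsP => //; have /ge0_sumsP <- // := bl.
transitivity (\sum_(0 <= j <oo) \sum_(0 <= k <oo) (a k j)%:E)%E.
  by apply: eq_eseriesr => j _; apply/esym/ge0_sumsP.
rewrite nneseries_interchange; last by move=> *; rewrite lee_fin.
by apply: eq_eseriesr => k _; apply/ge0_sumsP.
Qed.

Lemma sums_binomial (x y : R) n :
  sums (fun j => 'C(n, j)%:R * x ^+ (n - j) * y ^+ j) ((x + y) ^+ n).
Proof.
rewrite /sums; apply: (@cvg_near_cst _ _ _ _ _ _ _).
exists n.+1 => // m /= nm; rewrite exprDn /series /= (big_cat_nat (n := n.+1)) //=.
rewrite [X in _ + X]big1_seq ?addr0 => [|i]; last first.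
  by rewrite mem_index_iota => /andP[_] /andP[ni _]; rewrite bin_small // !mul0r.
by rewrite big_mkord; apply: eq_bigr => i _; rewrite -[RHS]mulr_natl; ring.
Qed.

(** Replaces the passages to the limit e -> 0 in the bounds for the mean. *)
Lemma ler_add_small (A B C : R) :
  (forall e, 0 < e <= 1 -> A <= C + e * B) -> A <= C.
Proof.
move=> H; rewrite leNgt; apply/negP => CA.
pose e := Num.min 1 ((A - C) / (2 * (`|B| + 1))).
have B1 : 0 < 2 * (`|B| + 1) by rewrite mulr_gt0 // ltr_wpDl.
have e0 : 0 < e by rewrite lt_min ltr01 divr_gt0 // subr_gt0.
have e1 : e <= 1 by rewrite ge_min lexx.
have e2 : e * (2 * (`|B| + 1)) <= A - C by rewrite -ler_pdivlMr // ge_min lexx orbT.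
have := H e; rewrite e0 e1 => /(_ isT).
have := ler_norm B; nra.
Qed.

(** The mean is the supremum of the slopes (1 - F z) / (1 - z) of the chords of
    the generating function at 1; in particular a law with F z >= z on [0, 1[ has
    mean at most 1. *)
Lemma mean_bounded (p : nat -> R) (F : R -> R) (C : R) n :
    (forall k, 0 <= p k) -> sums p 1 ->
    (forall z, 0 <= z < 1 -> sums (fun k => p k * z ^+ k) (F z)) ->
    (forall z, 0 <= z < 1 -> 1 - F z <= C * (1 - z)) ->
  series (fun k => k%:R * p k) n <= C.
Proof.
move=> p0 p1 pF FC.
apply: (@ler_add_small _ (series (fun k => k%:R * (k%:R * p k)) n)) => e /andP[e0 e1].
have z01 : 0 <= 1 - e < 1 by lra.
have := FC _ z01; rewrite (_ : 1 - (1 - e) = e); last ring.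
have pz k : 0 <= p k - p k * (1 - e) ^+ k.
  by rewrite subr_ge0 ler_piMr // exprn_ile1 //; lra.
move=> {FC} /(le_trans (ge0_sums_ge n pz (sumsB p1 (pF _ z01)))) FC.
suff : e * series (fun k => k%:R * p k) n - e * (e * series (fun k => k%:R * (k%:R * p k)) n)
    <= series (fun k => p k - p k * (1 - e) ^+ k) n.
  by move=> /le_trans /(_ FC); nra.
rewrite /series /= !mulr_sumr -sumrB; apply: ler_sum => k _.
rewrite [leLHS](_ : _ = p k * (k%:R * e * (1 - k%:R * e))); last ring.
rewrite [leRHS](_ : _ = p k * (1 - (1 - e) ^+ k)); last ring.
rewrite ler_wpM2l //.
case: k => [|k]; first by rewrite expr0 !mul0r subrr.
have e01 : 0 <= 1 - e <= 1 by lra.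
have := @exprB_ge _ (1 - e) 1 k; rewrite e01 expr1n => /(_ isT).
rewrite (_ : 1 - (1 - e) = e); last ring.
move=> /(le_trans _); apply; rewrite [leRHS]mulrAC.
apply: ler_wpM2l; first by rewrite mulr_ge0 // ltW.
have := @exprB_le _ (1 - e) 1 k; rewrite e01 expr1n lexx => /(_ isT isT).
rewrite (_ : 1 - (1 - e) = e); last ring.
rewrite -natr1; nra.
Qed.

End series_extra.
Arguments sums_binomial {R} x y n.

Section pruned_offspring.
Context {R : realType}.
Implicit Types (q : nat -> R).

(** The probability that the top vertex is not a leaf (hence the factor k != 0)
    and has exactly j offspring that are not leaves. *)
Definition thin q j : R := limn (series (fun k =>
  (k != 0)%:R * (q k * ('C(k, j)%:R * q 0 ^+ (k - j) * (1 - q 0) ^+ j)))).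

(** The law [thin q] has total mass 1 - q_0 and gives mass (1 - q_0) Q'(q_0)
    to 1 ([thin1]), so this is [thin q] conditioned on being different from 1. *)
Definition prune q j : R :=
  if j == 1%N then 0 else thin q j / ((1 - q 0) * (1 - dpgf q (q 0))).

Section fixed.
Variable q : nat -> R.
Hypothesis hq : subcritical_offspring q.

Let q_ge0 k : 0 <= q k. Proof. by case: hq => -[]. Qed.
Let q_0 : 0 <= 1 - q 0 <= 1. Proof. by case: hq => -[] /(_ 0) *; lra. Qed.
Let q_0' : 0 < 1 - q 0 <= 1. Proof. by case: hq => -[] /(_ 0) *; lra. Qed.
Let q_00 : 0 <= q 0 <= 1. Proof. by case: hq => -[] /(_ 0) *; lra. Qed.

Let bin_term_ge0 k j : 0 <= 'C(k, j)%:R * q 0 ^+ (k - j) * (1 - q 0) ^+ j.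
Proof. by case/andP: q_0 => ? _; rewrite !mulr_ge0 ?exprn_ge0. Qed.

Lemma thin_sums j : sums (fun k =>
  (k != 0)%:R * (q k * ('C(k, j)%:R * q 0 ^+ (k - j) * (1 - q 0) ^+ j))) (thin q j).
Proof.
have [k|l al _] := @sums_dom _ (fun k =>
  (k != 0)%:R * (q k * ('C(k, j)%:R * q 0 ^+ (k - j) * (1 - q 0) ^+ j))) _ _ _
  (offspring_sums hq); last by rewrite /thin (sums_lim al).
have b0 := bin_term_ge0 k j.
have b1 : 'C(k, j)%:R * q 0 ^+ (k - j) * (1 - q 0) ^+ j <= 1.
  rewrite -[leRHS](expr1n R k) (_ : 1 ^+ k = (q 0 + (1 - q 0)) ^+ k); last first.
    by rewrite addrC subrK.
  have := sums_binomial (q 0) (1 - q 0) k.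
  by move=> /(sums_term_le j (bin_term_ge0 k)).
case: (k != 0); rewrite ?mul0r ?mul1r ?lexx ?q_ge0 //.
by rewrite mulr_ge0 //= ler_piMr.
Qed.

Arguments thin_sums j : clear implicits.
Lemma thin_ge0 j : 0 <= thin q j.
Proof. by apply: sums_ge0 (thin_sums j) => k; rewrite mulr_ge0 // mulr_ge0. Qed.

Lemma thin1 : thin q 1 = (1 - q 0) * dpgf q (q 0).
Proof.
apply: sums_uniq (thin_sums 1) _; apply: eq_sums (sumsZ _ (dpgf_sums hq q_00)) => k.
case: k => [|k]; first by rewrite !mul0r mulr0.
by rewrite mul1r bin1 subn1 expr1 /=; ring.
Qed.

(** Thinning substitutes q_0 + (1 - q_0) z for z; removing the term k = 0
    subtracts q_0. *)
Lemma thin_pgf z : 0 <= z <= 1 ->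
  sums (fun j => thin q j * z ^+ j) (pgf q (q 0 + (1 - q 0) * z) - q 0).
Proof.
move=> /andP[z0 z1]; pose w := q 0 + (1 - q 0) * z.
have w01 : 0 <= w <= 1 by rewrite /w; case/andP: q_00 => *; nra.
apply: (@sums_interchange _ (fun k j =>
  (k != 0)%:R * (q k * ('C(k, j)%:R * q 0 ^+ (k - j) * (1 - q 0) ^+ j)) * z ^+ j)
  (fun k => (k != 0)%:R * (q k * w ^+ k))).
- by move=> k j; rewrite mulr_ge0 ?exprn_ge0 // mulr_ge0 // mulr_ge0.
- move=> k; apply: eq_sums (sumsZ _ (sumsZ _ (sums_binomial _ _ _))) => j.
  by rewrite exprMn; ring.
- by move=> j; rewrite [X in sums _ X]mulrC; apply: eq_sums (sumsZ (z ^+ j) (thin_sums j)) => k; rewrite mulrC.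
- have := @sums1 _ (fun k => (k == 0)%:R * q k) 0; rewrite eqxx mul1r => S0.
  apply: eq_sums (sumsB (pgf_sums hq w01) (S0 _)) => [[|k]|k /negPf ->].
  + by rewrite eqxx !mul0r expr0 mul1r mulr1 subrr.
  + by rewrite mul0r mul1r subr0.
  + by rewrite mul0r.
Qed.

Let t0 := 1 - q 0.

Lemma dgap_t0 : dgap q t0 = 1 - dpgf q (q 0).
Proof. by rewrite /dgap (_ : 1 - t0 = q 0) // /t0; ring. Qed.

Lemma prune_sums z : 0 <= z <= 1 ->
  sums (fun j => prune q j * z ^+ j) (z + gap q (t0 * (1 - z)) / (t0 * dgap q t0)).
Proof.
move=> z01; have dg := dgap_gt0 hq q_0'; have [t0_gt0 _] := andP q_0'.
have S1 := @sums1 _ (fun k => (k == 1)%:R * (thin q k * z)) 1.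
rewrite eqxx mul1r in S1.
have {}S1 : sums (fun k => (k == 1)%:R * (thin q k * z)) (thin q 1 * z).
  by apply: S1 => k /negPf ->; rewrite mul0r.
have D0 : t0 * dgap q t0 != 0 by rewrite mulf_neq0 // gt_eqF.
have dgE := dgap_t0.
have := sumsZ (t0 * dgap q t0)^-1 (sumsB (thin_pgf z01) S1).
rewrite thin1 [X in sums _ X](_ : _ = z + gap q (t0 * (1 - z)) / (t0 * dgap q t0)).
  apply: eq_sums => k; rewrite /prune; case: eqP => [->|_].
    by rewrite mul1r expr1 subrr mulr0 mul0r.
  by rewrite mul0r subr0 dgE mulrC mulrAC mulrC.
rewrite /gap (_ : 1 - t0 * (1 - z) = q 0 + (1 - q 0) * z); last by rewrite /t0; ring.
have -> : dpgf q (q 0) = 1 - dgap q t0 by rewrite dgE; ring.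
move: D0; set d := dgap q t0; rewrite mulf_eq0 negb_or => /andP[t0N dN].
by rewrite -/t0 (_ : q 0 = 1 - t0); [field; rewrite t0N dN|rewrite /t0; ring].
Qed.

Lemma prune_ge0 j : 0 <= prune q j.
Proof.
rewrite /prune; case: eqP => // _.
have := dgap_gt0 hq q_0'; rewrite dgap_t0 => dg.
by rewrite divr_ge0 ?thin_ge0 // mulr_ge0 // ?ltW //; case/andP: q_0'.
Qed.

Lemma gap0 : gap q 0 = 0.
Proof. by rewrite /gap subr0 (pgf1 hq) subrr. Qed.

Lemma prune0E : prune q 0 = gap q t0 / (t0 * dgap q t0).
Proof.
have /prune_sums : 0 <= (0 : R) <= 1 by rewrite lexx ler01.
rewrite add0r subr0 mulr1; apply: sums_uniq.
rewrite -[X in sums _ X]mulr1 -[X in sums _ (_ * X)](expr0 0).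
by apply: (@sums1 _ (fun k => prune q k * 0 ^+ k)) => -[|k] // _; rewrite expr0n mulr0.
Qed.

Lemma prune_sum1 : sums (prune q) 1.
Proof.
have /prune_sums : 0 <= (1 : R) <= 1 by rewrite lexx ler01.
rewrite subrr mulr0 gap0 mul0r addr0; apply: eq_sums => k.
by rewrite expr1n mulr1.
Qed.

(** The mean stays at most 1 because the new generating function is still above
    the diagonal. *)
Lemma prune_subcritical : subcritical_offspring (prune q).
Proof.
have dg := dgap_gt0 hq q_0'; have [t0_gt0 _] := andP q_0'.
split; first split.
- exact: prune_ge0.
- by apply/ge0_sumsP; [exact: prune_ge0|exact: prune_sum1].
- by rewrite /prune eqxx.
- by rewrite prune0E ltr_pdivrMr ?mulr_gt0 // mul1r gap_lt.
- have [k|n|m mS /andP[m0 m1]] := @sums_bounded _ (fun k => k%:R * prune q k) 1.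
  + by rewrite mulr_ge0 // prune_ge0.
  + apply: (mean_bounded n prune_ge0 prune_sum1) => z z01.
      by apply: prune_sums; case/andP: z01 => -> /ltW.
    rewrite mul1r lerB // lerDl divr_ge0 //; last by rewrite ltW // mulr_gt0.
    have ? : 0 < t0 * (1 - z) <= 1.
      case/andP: z01 => z0 z1; case/andP: q_0' => ? t1.
      by apply/andP; split; [apply: mulr_gt0|apply: mulr_ile1]; rewrite /t0; lra.
    by rewrite ltW // gap_gt0.
  + have -> : offspring_mean (prune q) = m%:E; last by rewrite lee_fin.
    by apply/ge0_sumsP => // k; rewrite mulr_ge0 // prune_ge0.
Qed.

(** One pruning is a zoom by the factor 1 - q_0, renormalised so that the
    derivative of the generating function vanishes at 0. *)
Lemma gap_prune t : 0 <= t <= 1 -> gap (prune q) t = gap q (t0 * t) / (t0 * dgap q t0).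
Proof.
move=> t01; have z01 : 0 <= 1 - t <= 1 by lra.
rewrite {1}/gap (sums_uniq (pgf_sums prune_subcritical z01) (prune_sums z01)).
by rewrite (_ : 1 - (1 - t) = t) ; ring.
Qed.

End fixed.
End pruned_offspring.

Arguments thin_sums {R q} hq j.

(** * The weight of the plane trees pruned to a given tree *)

Section plane_pruning.

Definition nonleaf u := offspring u != [::].

(** Pruning of a tree that hangs from an edge; on such trees it commutes with
    taking the subtrees, up to the suppression of the top vertex. *)
Definition plane_prune u := suppress_unary (drop_leaves u).

Definition prune_offspring s := [seq plane_prune u | u <- s & nonleaf u].

Lemma drop_leavesE s :
  drop_leaves (Node s) = Node [seq drop_leaves u | u <- s & nonleaf u].
Proof.
rewrite /=; congr Node; elim: s => //= -[[|u t]] s -> //.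
Qed.

Lemma plane_pruneE s : plane_prune (Node s) =
  if prune_offspring s is [:: v] then v else Node (prune_offspring s).
Proof. by rewrite /plane_prune drop_leavesE /= -map_comp. Qed.

Lemma leafP u : reflect (u = Node [::]) (~~ nonleaf u).
Proof.
by rewrite /nonleaf negbK; case: u => s; apply: (iffP eqP) => [/= ->|[]].
Qed.

End plane_pruning.

Section GW_pruning.
Context {R : realType}.
Implicit Types (q : nat -> R).

(** The probability of extinction is a fixed point of Q, and 1 is the only one. *)
Lemma GW_weight_total q : subcritical_offspring q ->
  (\esum_(u in setT) (GW_weight q u)%:E = 1)%E.
Proof.
move=> hq; have [hq1 _ _] := hq; have [q_ge0 _ _] := hq1.
have [m [m01 -> mE]] := GW_weight_fixpoint hq1.
have /andP[m0 m1] := m01; congr (_%:E).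
have mS : sums (fun k => q k * m ^+ k) m.
  by apply/ge0_sumsP => // k; rewrite mulr_ge0 // exprn_ge0.
apply/eqP; rewrite eq_le m1 /= leNgt; apply/negP => m_lt1.
have := @gap_gt0 _ _ hq (1 - m).
rewrite /gap (_ : 1 - (1 - m) = m); last ring.
rewrite (sums_uniq (pgf_sums hq m01) mS) subrr ltxx => H.
by have : false by apply: H; lra.
Qed.

Lemma GW_weight_unary q u : q 1 = 0 -> ~~ no_unary u -> GW_weight q u = 0.
Proof.
move=> q1; elim/plane_tree_ind2: u => s IH.
rewrite GW_weightE /= negb_and negbK => /orP[/eqP ->|]; first by rewrite q1 mul0r.
move=> Hs; suff -> : \prod_(u <- s) GW_weight q u = 0 by rewrite mulr0.
elim: IH Hs => //= u s' IHu _ IHs; rewrite negb_and big_cons.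
by case/orP => [/IHu ->|/IHs ->]; rewrite ?mul0r ?mulr0.
Qed.

Section fixed.
Variable q : nat -> R.
Hypothesis hq : subcritical_offspring q.

Let q_ge0 k : 0 <= q k. Proof. by case: hq => -[]. Qed.
Let q_1 : q 1 = 0. Proof. by case: hq => -[]. Qed.
Let q_0 : 0 < 1 - q 0 <= 1. Proof. by case: hq => -[] /(_ 0) *; lra. Qed.
Let w := GW_weight q.
Let w_ge0 u : 0 <= w u. Proof. exact: GW_weight_ge0. Qed.
Let wE_ge0 u : (0 <= (w u)%:E)%E. Proof. by rewrite lee_fin. Qed.
Let prod_w_ge0 s : (0 <= (\prod_(u <- s) w u)%:E)%E.
Proof. by rewrite lee_fin prodr_ge0. Qed.

(** A tree reduced to a leaf is excluded: it disappears, while [plane_prune]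
    sends it, as well as the trees all of whose offspring are leaves, to a
    leaf. *)
Definition prune_fiber (v : plane_tree) : set plane_tree :=
  [set u | nonleaf u] `&` plane_prune @^-1` [set v].

Definition fiber_weight v : R := fine (\esum_(u in prune_fiber v) (w u)%:E)%E.

Lemma fiber_weightE v :
  (\esum_(u in prune_fiber v) (w u)%:E = (fiber_weight v)%:E)%E.
Proof.
rewrite fineK // ge0_fin_numE; last exact: esum_ge0.
rewrite (le_lt_trans _ (ltry 1)) // -(GW_weight_total hq) [leLHS]esum_mkcond.
by apply: le_esum => u _; case: ifP.
Qed.

(** Reading the offspring from left to right, each one is a leaf, with weight q_0,
    or is pruned to the next tree of l; the binomial coefficient chooses the
    positions of the leaves, and the induction is Pascal's rule. *)
Lemma esum_words_fiber k l :
  (\esum_(s in words k `&` prune_offspring @^-1` [set l]) (\prod_(u <- s) w u)%:E =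
   ('C(k, size l)%:R * q 0 ^+ (k - size l) * \prod_(v <- l) fiber_weight v)%:E)%E.
Proof.
elim: k l => [|k IH] l.
  rewrite esum_mkcondr esum_words0; last by case: ifP.
  rewrite big_nil; case: l => [|v l] /=.
    by rewrite mem_set // bin0 subn0 expr0 big_nil !mulr1.
  by rewrite memNset // bin0n !mul0r.
rewrite esum_mkcondr esum_wordsS; last by move=> s; case: ifP.
pose E u := (\esum_(s in words k `&` [set s | prune_offspring (u :: s) = l])
              (\prod_(u <- s) w u)%:E)%E.
have step u : (\esum_(s in words k)
    (if u :: s \in prune_offspring @^-1` [set l] then (\prod_(x <- u :: s) w x)%:E
     else 0) = (w u)%:E * E u)%E.
  rewrite /E esum_mkcondr -esumZl //; last by move=> s; case: ifP.
  apply: eq_esum => s _; rewrite big_cons EFinM [in RHS]fun_if mule0.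
  by congr (if _ then _ else _); apply/idP/idP; rewrite !inE.
have E_ge0 u : (0 <= E u)%E by apply: esum_ge0.
under eq_esum do rewrite step.
rewrite (esumID [set u | nonleaf u]); last by move=> u _; rewrite mule_ge0.
have -> : [set: plane_tree] `&` ~` [set u | nonleaf u] = [set Node [::]].
  by apply/seteqP; split=> [u [_ /negP/leafP]|u /= ->].
rewrite esum_set1 ?mule_ge0 // {2}/E IH /w [GW_weight q _]GW_weightE /= big_nil mulr1 setTI.
case: l @E step E_ge0 => [|v l] E step E_ge0.
  rewrite esum1 => [|u /= nlu].
    rewrite add0e -EFinM !bin0 !subn0 big_nil exprS; congr (_%:E); ring.
  rewrite /E (_ : [set s | _] = set0) ?setI0 ?esum_set0 ?mule0 //.
  by apply/seteqP; split=> s //=; rewrite /prune_offspring /= nlu.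
pose e : R := 'C(k, size l)%:R * q 0 ^+ (k - size l) * \prod_(v <- l) fiber_weight v.
transitivity (\esum_(u in prune_fiber v) (e%:E * (w u)%:E) + 
  ((q 0)%:E * ('C(k, size (v :: l))%:R * q 0 ^+ (k - size (v :: l)) *
  \prod_(v0 <- (v :: l)) fiber_weight v0)%:E))%E.
  congr (_ + _)%E; rewrite /prune_fiber esum_mkcondr; apply: eq_esum => u /= nlu.
  rewrite /E; case: ifPn => uv.
    have {}uv : plane_prune u = v by move: uv; rewrite inE.
    rewrite muleC -IH; congr (_ * _)%E; congr (esum (_ `&` _) _).
    apply/seteqP; split=> s; rewrite /prune_offspring /= nlu /= uv; first by case.
    by move=> ->.
  rewrite (_ : [set s | _] = set0) ?setI0 ?esum_set0 ?mule0 //.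
  apply/seteqP; split=> s //=; rewrite /prune_offspring /= nlu => -[uv' _].
  by move: uv; rewrite -uv' mem_set.
have e0 : 0 <= e.
  by rewrite -lee_fin /e -IH; apply: esum_ge0.
rewrite esumZl // fiber_weightE -!EFinM -EFinD /e big_cons /=; congr (_%:E).
rewrite binS natrD subSS.
(* The exponent k - (size l + 1) is truncated when size l >= k, but the
   binomial coefficient then vanishes. *)
have -> : q 0 * ('C(k, (size l).+1)%:R * q 0 ^+ (k - (size l).+1) *
    (fiber_weight v * \prod_(j <- l) fiber_weight j)) =
  'C(k, (size l).+1)%:R * q 0 ^+ (k - size l) *
    (fiber_weight v * \prod_(j <- l) fiber_weight j).
  have [kl|kl] := ltnP (size l) k; last by rewrite bin_small // !mul0r mulr0.
  by rewrite -[(k - size l)%N]subnSK // exprS; ring.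
ring.
Qed.

(** A tree pruned to v = Node l has, besides leaves, either offspring pruned to
    the trees of l, or a single offspring pruned to v itself, in which case the
    top vertex is suppressed.  The second case contributes the fiber weight of v
    times Q'(q_0), whence the factor 1 - Q'(q_0).  The hypothesis on l makes the
    two cases exclusive. *)
Lemma fiber_weight_rec l : size l != 1%N ->
  fiber_weight (Node l) * (1 - dpgf q (q 0)) * (1 - q 0) ^+ size l =
  thin q (size l) * \prod_(v <- l) fiber_weight v.
Proof.
move=> l1; set v := Node l; set P := \prod_(v <- l) _.
have q00 : 0 <= q 0 <= 1 by case/andP: q_0 => *; lra.
have S1 := sumsZ P (thin_sums hq (size l)).
have S2 := sumsZ ((1 - q 0) ^+ size l * fiber_weight v) (dpgf_sums hq q00).
have S := sumsD S1 S2.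
suff {S} S' : sums (fun k => (k != 0)%:R * (q k * ('C(k, size l)%:R *
    q 0 ^+ (k - size l) * P + k%:R * q 0 ^+ k.-1 * fiber_weight v))) (fiber_weight v).
  have S'' := sumsZ ((1 - q 0) ^+ size l) S'.
  have : (1 - q 0) ^+ size l * fiber_weight v = P * thin q (size l) +
      (1 - q 0) ^+ size l * fiber_weight v * dpgf q (q 0).
    apply: sums_uniq S'' _; apply: eq_sums S => k.
    by case: k => [|k]; rewrite ?mul0r ?mul1r; ring.
  by rewrite mulrDr mulrN mulr1 mulrBl => H; rewrite [X in X - _]mulrC H; ring.
have P_ge0 k : 0 <= 'C(k, size l)%:R * q 0 ^+ (k - size l) * P.
  by rewrite -lee_fin -esum_words_fiber; apply: esum_ge0.
have v_ge0 : 0 <= fiber_weight v by rewrite -lee_fin -fiber_weightE; apply: esum_ge0.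
apply/ge0_sumsP.
  move=> k; do 2 apply: mulr_ge0 => //; apply: addr_ge0 => //.
  by do 2 apply: mulr_ge0 => //; apply: exprn_ge0; case/andP: q00.
rewrite -fiber_weightE [RHS]esum_mkcond esum_plane_tree; last by move=> u; case: ifP.
apply: eq_eseriesr => -[_|k _].
  rewrite mul0r esum1 // => s /= /size0nil ->; case: ifP => //.
  by rewrite inE => -[].
rewrite mul1r.
transitivity ((q k.+1)%:E * (
   \esum_(s in words k.+1 `&` prune_offspring @^-1` [set l]) (\prod_(u <- s) w u)%:E +
   \esum_(s in words k.+1 `&` prune_offspring @^-1` [set [:: v]]) (\prod_(u <- s) w u)%:E))%E.
  rewrite !esum_words_fiber -EFinD -EFinM /=; congr (_%:E); congr (_ * (_ + _)).
  by rewrite bin1 subn1 big_seq1.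
rewrite !esum_mkcondr -esumD; try by move=> s _; case: ifP.
rewrite -esumZl //; last by move=> s; rewrite adde_ge0 //; case: ifP.
apply: eq_esum => s sk.
have wsE : ((w (Node s))%:E = (q k.+1)%:E * (\prod_(u <- s) w u)%:E)%E.
  by rewrite /w GW_weightE /= sk EFinM.
have nls : nonleaf (Node s) by case: s sk {wsE}.
have -> : (Node s \in prune_fiber v) =
    (s \in prune_offspring @^-1` [set l]) || (s \in prune_offspring @^-1` [set [:: v]]).
  apply/idP/orP; rewrite !inE /prune_fiber /= plane_pruneE.
    case=> _; case: (prune_offspring s) => [|x [|y r]]; [|by move=> ->; right|].
      by case=> <-; left.
    by case=> <-; left.
  case=> ->; split=> //; rewrite /v; case: (l) l1 => [|x [|]] //.
case: ifPn => [sl|_]; last by rewrite add0e; case: ifP; rewrite ?mule0.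
rewrite /= ifN ?adde0 //; move: sl; rewrite inE => /= sl; apply/negP; rewrite inE /= sl.
by move=> lv; move: l1; rewrite lv.
Qed.

Lemma fiber_weight_prune v : no_unary v ->
  fiber_weight v = (1 - q 0) * GW_weight (prune q) v.
Proof.
elim/plane_tree_ind2: v => l IH /= /andP[l1 ul].
have lE : \prod_(v <- l) fiber_weight v =
    (1 - q 0) ^+ size l * \prod_(v <- l) GW_weight (prune q) v.
  elim: IH ul {l1} => [|v s Hv _ IHs] /=; first by rewrite !big_nil expr0 mulr1.
  by case/andP => /Hv vE /IHs sE; rewrite !big_cons vE sE exprS; ring.
have := fiber_weight_rec l1; rewrite {}lE big_map /prune (negPf l1).
have d0 : 1 - dpgf q (q 0) != 0.
  by have := dgap_gt0 hq q_0; rewrite dgap_t0 => /gt_eqF ->.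
have t0 : 1 - q 0 != 0 by case/andP: q_0 => /gt_eqF ->.
rewrite mulrCA mulrC => /(mulfI (expf_neq0 _ t0)) H.
by apply: (mulIf d0); rewrite H; field; rewrite t0 d0.
Qed.

End fixed.
End GW_pruning.

(** * Isomorphism classes and one pruning step on laws *)

Section isomorphism_classes.

(** Trees with a unary vertex have no planted reduced tree above them and are sent
    to an arbitrary value; their weight is 0. *)
Definition plant (u : plane_tree) : plane_planted := insubd plane_phi (Node [:: u]).

Definition planted_class (u : plane_tree) : tree := (\pi_tree (plant u))%qT.

Lemma val_plant u : no_unary u -> val (plant u) = Node [:: u].
Proof. by move=> uu; rewrite insubdK // -topredE /planted /reduced /= uu. Qed.

Lemma horton_planted_class u : no_unary u ->
  horton (planted_class u) =
    if nonleaf u then planted_class (plane_prune u) else phi.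
Proof.
move=> uu; rewrite /planted_class hortonE /phi.
rewrite (_ : planted_horton (plant u) =
  if nonleaf u then plant (plane_prune u) else plane_phi); first by case: ifP.
apply: val_inj; rewrite /= val_plant // /plane_horton drop_leavesE /=.
case: (nonleaf u) => //=.
by rewrite val_plant // no_unary_suppress.
Qed.

Lemma planted_class_neq_phi u : no_unary u -> planted_class u != phi.
Proof.
move=> uu; apply/negP => /eqP /eqmodP /asboolP; rewrite val_plant //=.
move=> /iso_inv [t ut tn]; move: ut; inversion tn.
by move/perm_size.
Qed.

(** Together with the finiteness of the set of permutations of a sequence, this
    bounds isomorphism classes by induction on the tree. *)
Lemma finite_Forall2 (A : choiceType) (P : A -> A -> Prop) (s : seq A) :
  List.Forall (fun x => finite_set [set y | P x y]) s ->
  finite_set [set v | List.Forall2 P s v].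
Proof.
elim: s => [_|x s IH H].
  apply: sub_finite_set (finite_set1 [::]) => v /= H; by inversion H.
inversion H as [|x' s' Px Ps]; subst.
have := finite_image (fun u : A * seq A => u.1 :: u.2) (finite_setX Px (IH Ps)).
apply: sub_finite_set => v /= H'; inversion H'; subst.
by exists (y, l').
Qed.

Lemma finite_iso t : finite_set [set u | iso t u].
Proof.
elim/plane_tree_ind2: t => s IH.
have : finite_set (\bigcup_(t in [set` permutations s])
    [set Node v | v in [set v | List.Forall2 iso t v]]).
  apply: bigcup_finite => [|t /=]; first exact: finite_seq.
  rewrite mem_permutations perm_sym => st; apply: finite_image.
  by apply: finite_Forall2; exact: Forall_perm IH st.
apply: sub_finite_set => -[u] /= /iso_inv [t st tu].
by exists t; [rewrite /= mem_permutations perm_sym|exists u].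
Qed.

Lemma finite_class (T : tree) : finite_set [set t : plane_planted | (\pi_tree t)%qT = T].
Proof.
have := @finite_preimage _ _ [set u | iso (val (repr T)) u] (val : plane_planted -> _).
move=> /(_ (fun _ _ _ _ => @val_inj _ _ _ _ _) (finite_iso _)).
apply: sub_finite_set => t /= tT; rewrite /preimage /=.
have /eqmodP/asboolP // : repr T = t %[mod tree]%qT by rewrite reprK tT.
Qed.

End isomorphism_classes.

Section GW_laws.
Context {R : realType}.
Implicit Types (q : nat -> R).

(** A planted tree is determined by the subtree hanging from its root, so the law
    is a sum over plane trees. *)
Lemma GW_esum q (A : set tree) : (forall k, 0 <= q k) -> q 1 = 0 ->
  (GW q A = \esum_(u in planted_class @^-1` A) (GW_weight q u)%:E)%E.
Proof.
move=> q0 q1; have w0 u : (0 <= (GW_weight q u)%:E)%E by rewrite lee_fin GW_weight_ge0.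
have m0 t : (0 <= (GW_mass q t)%:E)%E.
  by rewrite /GW_mass; case: offspring => [|u []].
pose N := [set u | no_unary u].
rewrite /GW (esumID (plant @` N)) // [RHS](esumID N) //.
rewrite [X in (_ + X)%E]esum1 ?adde0; last first.
  move=> [[s] hs] [_ /= nN]; rewrite /GW_mass /=.
  have [_ red_s] := andP hs; move: red_s; rewrite /reduced /=.
  case: s hs nN => [|u [|v s]] //= hs nN; rewrite andbT => uu; case: nN; exists u => //.
  by apply: val_inj; rewrite val_plant.
rewrite [X in (_ = _ + X)%E]esum1 ?adde0; last first.
  by move=> u [_ /negP uu]; rewrite GW_weight_unary.
rewrite (@reindex_esum R _ _ (planted_class @^-1` A `&` N) _ plant).
  by apply: eq_esum => u [_ uu]; rewrite /GW_mass val_plant.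
split=> [u [Au Nu]|u v|t [/= At [u Nu ut]]].
- by split=> //; exists u.
- rewrite !inE => -[_ Nu] [_ Nv] /(congr1 val); rewrite !val_plant //.
  by case.
- by exists u => //; split=> //; rewrite /preimage /= /planted_class ut.
Qed.

(** Sum [fiber_weight_prune] over the trees of an event: the pruned law is
    1 - q_0 times the Galton-Watson law of [prune q], of total mass 1. *)
Lemma pruning_step_GW q : subcritical_offspring q ->
  pruning_step (GW q) = GW (prune q).
Proof.
move=> hq; have [[q0 _ q1] q01 _] := hq; have hp := prune_subcritical hq.
have [[p0 _ p1] _ _] := hp.
have t0 : 0 < 1 - q 0 by lra.
have key A : GW q (horton @^-1` (A `&` [set T | T != phi])) = ((1 - q 0)%:E * GW (prune q) A)%E.
  rewrite !GW_esum // -esumZl ?ltW //; last by move=> u; rewrite lee_fin GW_weight_ge0.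
  transitivity (\esum_(u in [set u | nonleaf u] `&` plane_prune @^-1` (planted_class @^-1` A))
     (GW_weight q u)%:E)%E.
    rewrite [LHS]esum_mkcond [RHS]esum_mkcond; apply: eq_esum => u _.
    have [uu|uu] := boolP (no_unary u); last first.
      by rewrite GW_weight_unary //; do 2 case: ifP.
    congr (if _ then _ else _); apply/idP/idP; rewrite !inE /preimage /=;
      rewrite horton_planted_class //.
      by case: ifP => [_ []|_ []] //; rewrite eqxx.
    case=> -> Au; split=> //; apply: planted_class_neq_phi.
    exact: no_unary_suppress.
  rewrite esum_fiber; last by move=> u; rewrite lee_fin GW_weight_ge0.
  apply: eq_esum => v _; rewrite -EFinM.
  rewrite -/(prune_fiber v) fiber_weightE //; congr (_%:E).
  have [uv|uv] := boolP (no_unary v); first exact: fiber_weight_prune.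
  rewrite GW_weight_unary // mulr0 /fiber_weight.
  rewrite (_ : prune_fiber v = set0) ?esum_set0 //.
  apply/seteqP; split=> u // [_ /= vE]; move: uv; rewrite -vE.
  by rewrite no_unary_suppress.
apply/funext => A; rewrite /pruning_step /conditional /pushforward key.
rewrite -[X in horton @^-1` X]setTI key [X in (_ / (_ * X))%E]GW_esum //.
rewrite preimage_setT GW_weight_total // mule1 muleC muleA.
by rewrite inver gt_eqF // -EFinM mulVf ?gt_eqF // mul1e.
Qed.

Lemma pruned_lawE q k : subcritical_offspring q ->
  pruned_law (GW q) k = GW (iter k prune q) /\ subcritical_offspring (iter k prune q).
Proof.
move=> hq; elim: k => [|k [IH hk]]; first by split.
rewrite /pruned_law iterS -/(pruned_law _ k) IH pruning_step_GW //.
by split=> //=; exact: prune_subcritical.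
Qed.

(** An isomorphism class has finitely many plane embeddings, and each one has
    a weight that is polynomial in finitely many offspring probabilities. *)
Lemma cvg_GW (p : nat -> nat -> R) (r : nat -> R) (T : tree) :
    (forall n k, 0 <= p n k) -> (forall k, 0 <= r k) ->
    (forall k, p n k @[n --> \oo] --> r k) ->
  GW (p n) [set T] @[n --> \oo] --> GW r [set T].
Proof.
move=> p0 r0 pr.
have w_cvg u : GW_weight (p n) u @[n --> \oo] --> GW_weight r u.
  elim/plane_tree_ind2: u => s IH /=; under eq_fun do rewrite big_map.
  rewrite big_map; apply: cvgM => //.
  elim: IH => [|u s' Hu _ IHs]; first by under eq_fun do rewrite big_nil; rewrite big_nil; exact: cvg_cst.
  by under eq_fun do rewrite big_cons; rewrite big_cons; exact: cvgM.
have m_cvg t : GW_mass (p n) t @[n --> \oo] --> GW_mass r t.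
  by rewrite /GW_mass; case: (offspring _) => [|u [|v s]]; [exact: cvg_cst|exact: w_cvg|exact: cvg_cst].
have m_ge0 q t : (forall k, 0 <= q k) -> (0 <= (GW_mass q t)%:E)%E.
  by move=> q0; rewrite /GW_mass; case: offspring => [|u []] //; rewrite lee_fin GW_weight_ge0.
have [s GWE] : exists s : seq plane_planted, forall q : nat -> R, (forall k, 0 <= q k) ->
    GW q [set T] = (\sum_(t <- s) (GW_mass q t)%:E)%E.
  eexists => q q0; rewrite /GW (esum_fset (finite_class T)) => [|t _]; last exact: m_ge0.
  by rewrite fsbig_finite; [reflexivity|exact: finite_class].
rewrite GWE //; under eq_fun do rewrite GWE //.
apply: cvg_nnesum => t _; first by apply: nearW => n; exact: m_ge0.
by apply: cvg_EFin; [exact: nearW|exact: m_cvg].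
Qed.

End GW_laws.

(** * Continuity theorem for generating functions *)

Section pgf_continuity.
Context {R : realType}.
Implicit Types (z : R).

Lemma sums_tail_le (a b : nat -> R) l l' J :
    (forall k, (J <= k)%N -> a k <= b k) -> sums a l -> sums b l' ->
  l - series a J <= l' - series b J.
Proof.
elim: J a b l l' => [|J IH] a b l l' ab al bl.
  by rewrite /series /= !big_geq // !subr0; apply: ler_sums al bl => k; exact: ab.
have E c : series c J.+1 = c 0 + series (fun k => c k.+1) J :> R.
  by rewrite /series /= big_nat_recl.
by rewrite !E !opprD !addrA; exact: IH (fun k => ab k.+1) (sums_tail al) (sums_tail bl).
Qed.

(** Coefficients are at most 1, so the remainder is at most that of a geometric
    series, uniformly in the law. *)
Lemma pgf_tail (p : nat -> R) z l J : (forall j, p j <= 1) -> 0 <= z < 1 ->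
  sums (fun j => p j * z ^+ j) l ->
  l - series (fun j => p j * z ^+ j) J <= z ^+ J / (1 - z).
Proof.
move=> p1 /andP[z0 z1] pl.
have z1' : 1 - z != 0 by rewrite subr_eq0 eq_sym lt_eqF.
have gl : sums (geometric 1 z) (1 - z)^-1.
  by rewrite /sums -[X in _ --> X]mul1r; apply: cvg_geometric_series; rewrite ger0_norm.
apply: le_trans (sums_tail_le _ pl gl) _.
  by move=> k _ /=; rewrite ler_wpM2r // exprn_ge0.
rewrite geometric_seriesE /= ?lt_eqF // mul1r -[leLHS]/(_ - _).
by rewrite -{1}[_^-1]mul1r -mulrBl opprB addrC subrK.
Qed.

(** The first coefficient is within z / (1 - z) of the generating function at z,
    so its sequence is Cauchy; taking z small avoids any value at 0. *)
Lemma pgf_continuity0 (p : nat -> nat -> R) (f : nat -> R -> R) (F : R -> R) :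
    (forall n j, 0 <= p n j <= 1) ->
    (forall n z, 0 < z < 1 -> sums (fun j => p n j * z ^+ j) (f n z)) ->
    (forall z, 0 < z < 1 -> f n z @[n --> \oo] --> F z) ->
  exists l : R, p n 0 @[n --> \oo] --> l.
Proof.
move=> p01 pf fF; apply/cvg_ex/cauchy_cvgP/cauchy_exP => e e0.
(* Chosen so that z / (1 - z) = e / 2. *)
pose z := e / (2 + e).
have e2 : 0 < 2 + e by rewrite addr_gt0.
have z01 : 0 < z < 1 by rewrite divr_gt0 // ltr_pdivrMr // mul1r ltrDr /=.
have zE : z / (1 - z) = e / 2.
  by rewrite /z; field; rewrite gt_eqF //=; have -> : 2 + e - e = 2 :> R by ring.
have z01' : 0 <= z < 1 by case/andP: z01 => /ltW ->.
exists (F z); rewrite /fmapE -ball_normE /ball_.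
have /cvgrPdist_lt /(_ _ (divr_gt0 e0 (ltr0Sn R 1))) := fF _ z01.
apply: filterS => n /= H.
have p0 j : 0 <= p n j * z ^+ j.
  by rewrite mulr_ge0 ?exprn_ge0 //; [case/andP: (p01 n j)|case/andP: z01'].
have := pgf_tail 1 (fun j => (andP (p01 n j)).2) z01' (pf n z z01).
have := ge0_sums_ge 1 p0 (pf n z z01).
rewrite /series /= big_nat1 expr0 mulr1 expr1 zE => h1 h2.
rewrite -(subrKA (f n z)) (le_lt_trans (ler_normD _ _)) //.
rewrite [ltRHS](splitr e) ltr_leD // ger0_norm ?subr_ge0 //.
Qed.

(** Subtracting the first coefficient and dividing by z shifts the sequence, so
    the convergence of the first coefficient gives that of all of them; the
    uniform bound on the remainders then identifies the limit series.  Values of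
    the generating functions at z = 0 are left out because this division loses
    them. *)
Lemma pgf_continuity (p : nat -> nat -> R) (f : nat -> R -> R) (F : R -> R) :
    (forall n j, 0 <= p n j <= 1) ->
    (forall n z, 0 < z < 1 -> sums (fun j => p n j * z ^+ j) (f n z)) ->
    (forall z, 0 < z < 1 -> f n z @[n --> \oo] --> F z) ->
  exists r : nat -> R, (forall j, p n j @[n --> \oo] --> r j) /\
    (forall z, 0 < z < 1 -> sums (fun j => r j * z ^+ j) (F z)).
Proof.
move=> p01 pf fF.
suff [r pr] : exists r : nat -> R, forall j, p n j @[n --> \oo] --> r j.
  exists r; split=> // z z01; have /andP[z0 z1] := z01.
  have tail J : 0 <= F z - series (fun j => r j * z ^+ j) J <= z ^+ J / (1 - z).
    have cv : f n z - series (fun j => p n j * z ^+ j) J @[n --> \oo] -->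
        F z - series (fun j => r j * z ^+ j) J.
      apply: cvgB; first exact: fF.
      rewrite /series /=; apply: (@cvg_big R _ _ _ _ _ _ _ _ (fun j n => p n j * z ^+ j)) => //.
        exact: add_continuous.
      by move=> j _; apply: cvgMr_tmp.
    apply/andP; split.
      apply: cvgr_to_ge cv _; apply: nearW => n; rewrite subr_ge0.
      apply: ge0_sums_ge (pf n _ z01) => j.
      by rewrite mulr_ge0 // ?exprn_ge0 ?(ltW z0) //; case/andP: (p01 n j).
    apply: cvgr_to_le cv _; apply: nearW => n; apply: pgf_tail (pf n _ z01).
      by move=> j; case/andP: (p01 n j).
    by rewrite (ltW z0).
  rewrite /sums -[F z]subr0.
  rewrite (_ : series _ = fun J => F z - (F z - series (fun j => r j * z ^+ j) J)).
    apply: cvgB; first exact: cvg_cst.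
    apply: (@squeeze_cvgr _ _ _ _ (fun=> 0) (fun J => z ^+ J / (1 - z))).
    - by apply: nearW => J; exact: tail.
    - exact: cvg_cst.
    - rewrite -[X in _ --> X](mul0r (1 - z)^-1); apply: cvgMr_tmp.
      by apply: cvg_expr; rewrite ger0_norm // ltW.
  by apply/funext => J; rewrite opprB addrC subrK.
suff /choice [r pr] : forall j, exists l : R, p n j @[n --> \oo] --> l by exists r.
move=> j; elim: j p f F p01 pf fF => [|j IH] p f F p01 pf fF.
  exact: pgf_continuity0 pf fF.
have [l pl] := pgf_continuity0 p01 pf fF.
apply: (IH (fun n j => p n j.+1) (fun n z => z^-1 * (f n z - p n 0))
    (fun z => z^-1 * (F z - l))) => [n k|n z z01|z z01] //.
  have z0 : z != 0 by case/andP: z01 => /gt_eqF ->.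
  have := sumsZ z^-1 (sums_tail (pf n z z01)); rewrite expr0 mulr1.
  by apply: eq_sums => k; rewrite exprS; field; exact: z0.
by apply: cvgMl_tmp; apply: cvgB => //; exact: fF.
Qed.

End pgf_continuity.

(** * Newton iteration and regular variation *)

Section newton_iteration.
Context {R : realType}.
Variable q : nat -> R.
Hypothesis hq : subcritical_offspring q.

(** Newton's iterates for the zero 0 of g, started at 1; 1 - newton k is the k-th
    iterate of S at 0. *)
Fixpoint newton k : R :=
  if k is k'.+1 then newton k' - gap q (newton k') / dgap q (newton k') else 1.

Lemma newton_step a : 0 < a <= 1 -> 0 < a - gap q a / dgap q a < a.
Proof.
move=> a01; have g0 := gap_gt0 hq a01; have d0 := dgap_gt0 hq a01.
rewrite subr_gt0 ltr_pdivrMr // gap_lt //= ltrBlDr ltrDl.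
by rewrite divr_gt0.
Qed.

Lemma newton01 k : 0 < newton k <= 1.
Proof.
elim: k => [|k IH] /=; first by rewrite ltr01 lexx.
case/andP: (newton_step IH) => -> /ltW /le_trans; apply.
by case/andP: IH.
Qed.

Lemma newton_ge0 k : 0 <= newton k.
Proof. by case/andP: (newton01 k) => /ltW. Qed.

Lemma newton_decr : nonincreasing_seq newton.
Proof.
apply/nonincreasing_seqP => k; have /andP[_ /ltW] := newton_step (newton01 k); exact.
Qed.

(** If the decreasing iterates had a limit l > 0, each step would be at least
    g(l) / 1, since g is nondecreasing and g' <= 1; finitely many such steps would
    exhaust the starting value 1. *)
Lemma newton_cvg0 : newton k @[k --> \oo] --> 0.
Proof.
have lb : has_lbound (range newton) by exists 0 => _ [k _ <-]; exact: newton_ge0.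
have cv := nonincreasing_is_cvgn newton_decr lb.
set l := limn newton; have ln k : l <= newton k by exact: nonincreasing_cvgn_ge newton_decr cv k.
suff l0 : l <= 0.
  have -> : 0 = l; last exact: cv.
  apply/eqP; rewrite eq_le l0 andbT; apply: limr_ge => //.
  by apply: nearW => k; exact: newton_ge0.
rewrite leNgt; apply/negP => l0.
have l01 : 0 < l <= 1 by rewrite l0 (le_trans (ln 0)).
have gl := gap_gt0 hq l01.
have step k : newton k <= 1 - k%:R * gap q l.
  elim: k => [|k IH]; first by rewrite mul0r subr0.
  rewrite -natr1 mulrDl mul1r opprD addrA /= lerB //.
  case/andP: (newton01 k) => n0 n1.
  apply: le_trans (_ : gap q (newton k) <= _); first by rewrite le_gap // ltW ?l0 ?ln.
  rewrite ler_pdivlMr ?dgap_gt0 ?n0 //; rewrite ler_piMr //.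
    by apply: ltW; rewrite gap_gt0 // n0.
  by rewrite dgap_le1 // ltW.
have Hn := Num.Theory.truncnS_gt (gap q l)^-1; move: Hn; set n := _.+1 => Hn.
rewrite -[X in X < _]mul1r ltr_pdivrMr // in Hn.
by have := step n; have := newton_ge0 n; lra.
Qed.

(** Zooms compose: if the current function is g(a t) / (a g'(a)), the next zoom
    factor b = 1 - p_0 is 1 - g(a) / (a g'(a)), so a b is the next Newton
    iterate.  Evaluating the new normalisation uses the derivative of the current
    function at b, an interior point of [0, 1]. *)
Lemma gap_iter_prune k :
  subcritical_offspring (iter k prune q) /\
  forall t, 0 <= t <= 1 -> gap (iter k prune q) t =
    gap q (newton k * t) / (newton k * dgap q (newton k)).
Proof.
elim: k => [|k [hp gp]].
  split=> // t _; rewrite /= !mul1r.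
  suff -> : dgap q 1 = 1 by rewrite divr1.
  have H01 : 0 <= (0 : R) <= 1 by rewrite lexx ler01.
  rewrite /dgap subrr -[RHS]subr0; congr (_ - _).
  apply: sums_uniq (dpgf_sums hq H01) _.
  rewrite [X in sums _ X](_ : 0 = 1%:R * q 1 * 0 ^+ 1.-1); last first.
    by case: hq => -[_ _ ->] _ _; rewrite mulr0 mul0r.
  apply: (@sums1 _ (fun k => k%:R * q k * 0 ^+ k.-1)) => -[|[|j]] // _.
    by rewrite !mul0r.
  by rewrite expr0n mulr0.
rewrite iterS; split; first exact: prune_subcritical.
set p := iter k prune q in hp gp *; set a := newton k in gp.
have a01 : 0 < a <= 1 := newton01 k.
have [a0 a1] := andP a01.
have da := dgap_gt0 hq a01.
set b := 1 - p 0.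
have bE : newton k.+1 = a * b.
  have H11 : 0 <= (1 : R) <= 1 by rewrite lexx ler01.
  have := gp 1 H11; rewrite /gap subrr (pgf0 hp) subr0 mulr1 -/(gap q a) => p0E.
  rewrite /b p0E /= -/a; field.
  by rewrite !gt_eqF.
have /andP[b0 b1] : 0 < b < 1.
  have := newton_step a01; rewrite -[_ - _]/(newton k.+1) bE pmulr_rgt0 //.
  by rewrite gtr_pMr.
have ab01 : 0 < a * b <= 1 by rewrite -bE newton01.
have dab := dgap_gt0 hq ab01.
have dE : dgap p b = dgap q (a * b) / dgap q a.
  have b01 : 0 < b <= 1 by rewrite b0 ltW.
  have [_ <-] := is_derive_gap hp b01.
  have D1 : is_derive b 1 (fun t : R => a * t) a.
    by apply: (is_derive_eq (is_deriveZ a (is_derive_id b 1))); rewrite [_ *: _]mulr1.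
  have D2 : is_derive b 1 (fun t => gap q (a * t)) (dgap q (a * b) *: a).
    by apply: is_derive1_comp; exact: is_derive_gap.
  have D3 := is_deriveZ (a * dgap q a)^-1 D2.
  have [_ <-] : is_derive b 1 (gap p) (dgap q (a * b) / dgap q a).
    apply: (@near_eq_is_derive _ _ _ ((a * dgap q a)^-1 *: (fun t => gap q (a * t)))).
      have b_itv : b \in `]0, 1[ by rewrite in_itv /= b0.
      apply: filterS (near_in_itvoo b_itv) => t; rewrite in_itv /= => /andP[t0 t1].
      by rewrite gp ?(ltW t0) ?(ltW t1) // [RHS]mulrC.
    apply: (is_derive_eq D3); rewrite /GRing.scale /=; field.
    by rewrite !gt_eqF.
  by [].
move=> t t01; rewrite gap_prune // bE -/b gp; last first.
  case/andP: t01 => t0 t1; apply/andP.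
  by split; [apply: mulr_ge0 => //; exact: ltW|apply: mulr_ile1 => //; exact: ltW].
rewrite dE [a * (b * t)]mulrA; field.
by rewrite !gt_eqF.
Qed.

Lemma pgf_iter_prune k z : 0 <= z <= 1 -> pgf (iter k prune q) z =
  z + gap q (newton k * (1 - z)) / (newton k * dgap q (newton k)).
Proof.
move=> z01; have [_ E] := gap_iter_prune k; rewrite -E; last by lra.
by rewrite /gap (_ : 1 - (1 - z) = z) ; ring.
Qed.

Lemma iter_prune0 k :
  iter k prune q 0 = gap q (newton k) / (newton k * dgap q (newton k)).
Proof.
have H01 : 0 <= (0 : R) <= 1 by rewrite lexx ler01.
by rewrite -(pgf0 (gap_iter_prune k).1) pgf_iter_prune // subr0 mulr1 add0r.
Qed.

Section ratio.
Variable L : R.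
Hypothesis hL : (1 - S_fun q x) / (1 - x) @[x --> 1^'-] --> L.

(** At x = 1 - t one has (1 - S x) / (1 - x) = 1 - g(t) / (t g'(t)). *)
Lemma gap_ratio_cvg (t : nat -> R) : (forall k, 0 < t k <= 1) ->
  t k @[k --> \oo] --> 0 ->
  gap q (t k) / (t k * dgap q (t k)) @[k --> \oo] --> 1 - L.
Proof.
move=> t01 t0; have /cvg_at_leftP := hL; move=> /(_ (fun k => 1 - t k)).
have H : (forall n, 1 - t n < 1) /\ 1 - t n @[n --> \oo] --> (1 : R).
  split=> [n|]; first by rewrite gtrBl; case/andP: (t01 n).
  by rewrite -[X in _ --> X](subr0 1); apply: cvgB => //; exact: cvg_cst.
move=> /(_ H) {}H.
rewrite (_ : (fun k => _) = (fun k => 1 - (1 - S_fun q (1 - t k)) / (1 - (1 - t k)))).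
  by apply: cvgB H; exact: cvg_cst.
apply/funext => k; have d0 := dgap_gt0 hq (t01 k); have /andP[t0k t1k] := t01 k.
rewrite (S_funE hq); last by lra.
have gE : gap q (t k) = pgf q (1 - t k) - (1 - t k) by [].
have dE : dgap q (t k) = 1 - dpgf q (1 - t k) by [].
have -> : pgf q (1 - t k) = gap q (t k) + (1 - t k) by rewrite gE; ring.
have -> : dpgf q (1 - t k) = 1 - dgap q (t k) by rewrite dE; ring.
rewrite (_ : 1 - (1 - dgap q (t k)) = dgap q (t k)); last ring.
rewrite (_ : 1 - (1 - t k) = t k); last ring.
by field; rewrite !gt_eqF.
Qed.

Lemma ratio_range : critical q -> 1 / 2 <= 1 - L <= 1.
Proof.
move=> cq; have cv := gap_ratio_cvg newton01 newton_cvg0; apply/andP; split.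
  apply: cvgr_to_ge cv _; apply: nearW => k.
  have := gap_ge_half hq cq (newton01 k); have /andP[a0 _] := newton01 k.
  by rewrite ler_pdivlMr ?mulr_gt0 ?dgap_gt0 ?newton01 //; lra.
apply: cvgr_to_le cv _; apply: nearW => k.
have := gap_lt hq (newton01 k); have /andP[a0 _] := newton01 k.
by rewrite ler_pdivrMr ?mulr_gt0 ?dgap_gt0 ?newton01 // mul1r => /ltW.
Qed.

(** The mean value theorem for y |-> ln (g (exp y)), whose derivative is
    x g'(x) / g(x) at x = exp y. *)
Lemma ln_gap_mean_value c t : 0 < c < 1 -> 0 < t <= 1 ->
  exists2 x, 0 < x <= t &
    ln (gap q t) - ln (gap q (c * t)) = x * dgap q x / gap q x * - ln c.
Proof.
move=> /andP[c0 c1] /andP[t0 t1].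
have ct0 : 0 < c * t by rewrite mulr_gt0.
have lct : ln (c * t) < ln t by rewrite ltr_ln ?posrE // gtr_pMl.
have expP y : y \in `[ln (c * t), ln t] -> 0 < expR y <= t.
  rewrite in_itv /= => /andP[_ yt]; rewrite expR_gt0 /=.
  by rewrite -[leRHS]lnK ?posrE // ler_expR.
have D y : y \in `[ln (c * t), ln t] -> is_derive y 1 (fun y => ln (gap q (expR y)))
    (expR y * dgap q (expR y) / gap q (expR y)).
  move=> /expP /andP[e0 et].
  have e01 : 0 < expR y <= 1 by rewrite e0 (le_trans et).
  have D1 : is_derive y 1 (fun y => gap q (expR y)) (dgap q (expR y) *: expR y).
    by apply: is_derive1_comp; exact: is_derive_gap.
  have D2 : is_derive y 1 (fun y => ln (gap q (expR y)))
      ((gap q (expR y))^-1 *: (dgap q (expR y) *: expR y)).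
    by apply: is_derive1_comp; apply: is_derive1_ln; exact: gap_gt0.
  by apply: (is_derive_eq D2); rewrite /GRing.scale /=; ring.
have Doo y : y \in `]ln (c * t), ln t[ -> is_derive y 1 (fun y => ln (gap q (expR y)))
    (expR y * dgap q (expR y) / gap q (expR y)).
  by move=> yI; apply: D; exact: subset_itv_oo_cc yI.
have cont : {within `[ln (c * t), ln t], continuous (fun y => ln (gap q (expR y)))}.
  by apply: derivable_within_continuous => y yI; exact: (@ex_derive _ _ _ _ _ _ _ (D y yI)).
have [y yI] := @MVT_segment R (fun y => ln (gap q (expR y)))
  (fun y => expR y * dgap q (expR y) / gap q (expR y)) (ln (c * t)) (ln t) (ltW lct) Doo cont.
rewrite !lnK ?posrE // lnM ?posrE // => E.
by exists (expR y); [exact: expP|rewrite E; ring].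
Qed.

(** In [ln_gap_mean_value] the factor x g'(x) / g(x) tends to 1 / r along the
    intermediate points, which tend to 0 as they are bounded by t k. *)
Lemma gap_regular_variation c (t : nat -> R) : 0 < 1 - L -> 0 < c <= 1 ->
    (forall k, 0 < t k <= 1) -> t k @[k --> \oo] --> 0 ->
  gap q (c * t k) / gap q (t k) @[k --> \oo] --> c `^ (1 / (1 - L)).
Proof.
move=> r0 /andP[c0]; rewrite le_eqVlt => /orP[/eqP -> t01 _|c1 t01 t0].
  rewrite powR1; apply: cvg_near_cst; apply: nearW => k.
  by rewrite mul1r mulfV // gt_eqF // gap_gt0.
have c01 : 0 < c < 1 by rewrite c0.
have /choice [x xP] k : exists x, 0 < x <= t k /\
    ln (gap q (t k)) - ln (gap q (c * t k)) = x * dgap q x / gap q x * - ln c.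
  by have [x ? ?] := ln_gap_mean_value c01 (t01 k); exists x.
have x01 k : 0 < x k <= 1.
  by have [/andP[-> /le_trans ->]] := xP k; case/andP: (t01 k).
have x0 : x k @[k --> \oo] --> 0.
  apply: (@squeeze_cvgr _ _ _ _ (fun=> 0) t) => //; last exact: cvg_cst.
  by apply: nearW => k; have [/andP[/ltW -> ->]] := xP k.
have ct01 k : 0 < c * t k <= 1.
  by have /andP[t0k t1k] := t01 k; rewrite mulr_gt0 //= mulr_ile1 // ltW.
rewrite /powR gt_eqF //.
rewrite (_ : (fun k => _) = (fun k => expR (x k * dgap q (x k) / gap q (x k) * ln c))).
  apply: continuous_cvg; first exact: continuous_expR.
  apply: cvgMr_tmp; rewrite div1r.
  rewrite (_ : (fun k => _) = (fun k => (gap q (x k) / (x k * dgap q (x k)))^-1)).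
    by apply: cvgV; [rewrite gt_eqF|exact: gap_ratio_cvg].
  by apply/funext => k; rewrite invf_div.
apply/funext => k; have [_ E] := xP k.
have -> : x k * dgap q (x k) / gap q (x k) * ln c =
    ln (gap q (c * t k) / gap q (t k)).
  by rewrite ln_div ?posrE ?gap_gt0 // -opprB E; ring.
by rewrite lnK // posrE divr_gt0 ?gap_gt0.
Qed.

Lemma pgf_iter_prune_cvg z : 0 < 1 - L -> 0 <= z < 1 ->
  pgf (iter k prune q) z @[k --> \oo] --> z + (1 - L) * (1 - z) `^ (1 / (1 - L)).
Proof.
move=> r0 /andP[z0 z1].
have c01 : 0 < 1 - z <= 1 by lra.
have z01 : 0 <= z <= 1 by lra.
under eq_fun do rewrite pgf_iter_prune //.
apply: cvgD; first exact: cvg_cst.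
rewrite (_ : (fun k => _) = (fun k => gap q (newton k) / (newton k * dgap q (newton k)) *
   (gap q ((1 - z) * newton k) / gap q (newton k)))).
  apply: cvgM; first exact: gap_ratio_cvg newton01 newton_cvg0.
  exact: gap_regular_variation r0 c01 newton01 newton_cvg0.
apply/funext => k; have /andP[a0 a1] := newton01 k.
rewrite [(1 - z) * _]mulrC; field.
by rewrite !gt_eqF ?dgap_gt0 ?gap_gt0 ?newton01.
Qed.

End ratio.

(** Both g(t) / t and g'(t) tend to g'(0) = 1 - m > 0: g(t) >= (1 - m) t because Q
    has slopes at most m, and g'(t) is bounded above by truncating the series of
    Q' and letting t tend to 0 before the truncation is removed. *)
Lemma subcritical_ratio_cvg : subcritical q ->
  gap q (newton k) / (newton k * dgap q (newton k)) @[k --> \oo] --> (1 : R).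
Proof.
move=> sq; have [m [mS /andP[m0 _] mE]] := offspring_mean_sums hq.
have m1 : m < 1 by move: sq; rewrite /subcritical mE lte_fin.
have q0 k : 0 <= q k by case: hq => -[].
have gap_ge t : 0 < t <= 1 -> (1 - m) * t <= gap q t.
  move=> /andP[t0 t1]; have t01 : 0 <= 1 - t <= 1 by lra.
  have := ler_sums _ (sumsB (offspring_sums hq) (pgf_sums hq t01)) (sumsZ t mS).
  rewrite /gap => H; suff /H : forall k, q k - q k * (1 - t) ^+ k <= t * (k%:R * q k) by lra.
  move=> k; have := @exprB_le _ (1 - t) 1 k; rewrite t01 expr1n lexx => /(_ isT isT).
  by move=> /(ler_wpM2l (q0 k)); lra.
have dgap_ge t : 0 < t <= 1 -> 1 - m <= dgap q t.
  move=> t01; have := gap_ge t t01; have := gap_lt hq t01; have /andP[t0 _] := t01.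
  by move=> /ltW H1 H2; have := le_trans H2 H1; rewrite mulrC ler_pM2l.
have dgap_le t n : 0 < t <= 1 ->
    dgap q t <= 1 - series (fun k => k%:R * q k) n + t * series (fun k => k%:R * (k%:R * q k)) n.
  move=> /andP[t0 t1]; have t01 : 0 <= 1 - t <= 1 by lra.
  have T0 k : 0 <= k%:R * q k * (1 - t) ^+ k.-1.
    by rewrite mulr_ge0 ?exprn_ge0 //; [rewrite mulr_ge0|lra].
  have := ge0_sums_ge n T0 (dpgf_sums hq t01); rewrite /dgap => H.
  suff : series (fun k => k%:R * q k) n - t * series (fun k => k%:R * (k%:R * q k)) n <=
    series (fun k => k%:R * q k * (1 - t) ^+ k.-1) n by lra.
  rewrite /series /= mulr_sumr -sumrB; apply: ler_sum => k _.
  have kq : 0 <= k%:R * q k by rewrite mulr_ge0.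
  have := @exprB_le _ (1 - t) 1 k.-1; rewrite t01 expr1n lexx => /(_ isT isT).
  have : k.-1%:R <= k%:R :> R by rewrite ler_nat leq_pred.
  move=> /(ler_wpM2r (ltW t0)) h1 h2.
  have : 1 - k%:R * t <= (1 - t) ^+ k.-1 by lra.
  by move=> /(ler_wpM2l kq); lra.
have dcv : dgap q (newton k) @[k --> \oo] --> 1 - m.
  apply/cvgrPdist_le => e e0.
  have e2 : 0 < e / 2 by rewrite divr_gt0.
  have /cvgrPdist_le /(_ _ e2) [n _ /(_ n (leqnn n))] := mS.
  set S1 := series _ n => hS1; pose S2 := series (fun k => k%:R * (k%:R * q k)) n.
  have : newton k * S2 @[k --> \oo] --> 0.
    by rewrite -[X in _ --> X](mul0r S2); apply: cvgMr_tmp; exact: newton_cvg0.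
  move=> /cvgrPdist_le /(_ _ e2); apply: filterS => k; rewrite sub0r normrN => hk.
  have := dgap_ge _ (newton01 k); have := dgap_le _ n (newton01 k).
  rewrite -/S1 -/S2 => h1 h2; rewrite distrC ger0_norm ?subr_ge0 //.
  have := le_trans (ler_norm _) hk; have := le_trans (ler_norm _) hS1; lra.
apply: (@squeeze_cvgr _ _ _ _ (fun k => (1 - m) / dgap q (newton k)) (fun=> 1)).
- apply: nearW => k; have a01 := newton01 k; have /andP[a0 a1] := a01.
  have d0 := dgap_gt0 hq a01.
  rewrite ler_pdivlMr ?mulr_gt0 // ler_pdivrMr ?mulr_gt0 // mul1r.
  rewrite (ltW (gap_lt hq a01)) andbT (le_trans _ (gap_ge _ a01)) //.
  by rewrite mulrCA -!mulrA mulVf ?mulr1 ?gt_eqF // mulrC.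
- rewrite -[X in _ --> X](@mulfV _ (1 - m)); last by rewrite subr_eq0 gt_eqF.
  by apply: cvgM; [exact: cvg_cst|apply: cvgV => //; rewrite subr_eq0 gt_eqF].
- exact: cvg_cst.
Qed.

End newton_iteration.

(** * The limit laws *)

Section limits.
Context {R : realType}.
Implicit Types (q : nat -> R).

(** The remaining mass 1 - p_0 bounds every other probability. *)
Lemma cvg_leaf_offspring (p : nat -> nat -> R) :
    (forall n, subcritical_offspring (p n)) -> p n 0 @[n --> \oo] --> (1 : R) ->
  forall j, p n j @[n --> \oo] --> @leaf_offspring R j.
Proof.
move=> hp p0 [|j]; first exact: p0.
have p_ge0 n k : 0 <= p n k by case: (hp n) => -[].
apply: (@squeeze_cvgr _ _ _ _ (fun=> 0) (fun n => 1 - p n 0)).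
- apply: nearW => n; rewrite p_ge0 lerBrDl /=.
  have := ge0_sums_ge j.+2 (p_ge0 n) (offspring_sums (hp n)).
  apply: le_trans; rewrite /series /= big_nat_recl // big_nat_recr //= addrA.
  by rewrite lerD2r lerDl sumr_ge0.
- exact: cvg_cst.
- by rewrite -[X in _ --> X](subrr 1); apply: cvgB => //; exact: cvg_cst.
Qed.

(** The total mass and the mean are read off at the point 1 of the generating
    function F z = z + r (1 - z)^(1/r): it tends to 1 there since F z >= z, and
    its chords at 1 have slopes 1 - r (1 - z)^(1/r - 1), which tend to 1 since
    r < 1. *)
Lemma IGW_offspring (p : nat -> R) (r : R) : 1 / 2 <= r < 1 ->
    (forall k, 0 <= p k) -> p 1 = 0 -> (forall n, series p n <= 1) ->
    (forall z, 0 <= z < 1 ->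
      sums (fun k => p k * z ^+ k) (z + r * (1 - z) `^ (1 / r))) ->
  offspring_distribution p /\ critical p.
Proof.
move=> /andP[r2 r1] p0 p1 ps pF; have r0 : 0 < r by lra.
have [s sP /andP[s0 s1]] := sums_bounded p0 ps.
have {s0 s1} sE : s = 1.
  apply/eqP; rewrite eq_le s1 /=; apply: (@ler_add_small _ _ 1 _) => e /andP[e0 e1].
  have z01 : 0 <= 1 - e < 1 by lra.
  have zs : (1 - e) + r * (1 - (1 - e)) `^ (1 / r) <= s.
    apply: ler_sums (pF _ z01) sP => k.
    by rewrite ler_piMr // exprn_ile1 //; lra.
  have := powR_ge0 (1 - (1 - e)) (1 / r); move: zs; set w := _ `^ _ => zs w0.
  have : 0 <= r * w by rewrite mulr_ge0 // ltW.
  lra.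
rewrite {}sE in sP.
have [k|n|m mS /andP[m0 m1]] := @sums_bounded _ (fun k => k%:R * p k) 1.
- by rewrite mulr_ge0.
- apply: (mean_bounded n p0 sP pF) => z /andP[z0 z1]; rewrite [leRHS]mul1r lerB // lerDl.
  by rewrite mulr_ge0 ?powR_ge0 // ltW.
split; first by split => //; apply/ge0_sumsP.
rewrite /critical (_ : offspring_mean p = m%:E); last first.
  by apply/ge0_sumsP => // k; rewrite mulr_ge0.
congr (_%:E); apply/eqP; rewrite eq_le m1 /=.
apply: (@ler_add_small _ _ r _) => e /andP[e0 e1].
pose b := 1 / r - 1.
have b0 : 0 < b by rewrite subr_gt0 ltr_pdivlMr // mul1r.
(* Chosen so that t^(1/r - 1) = e. *)
pose t := e `^ b^-1.
have t0 : 0 < t by exact: powR_gt0.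
have t1 : t <= 1.
  rewrite [leRHS](_ : 1 = 1 `^ b^-1); last by rewrite powR1.
  by rewrite ge0_ler_powR ?nnegrE ?invr_ge0 // ltW.
have tE : t `^ (1 / r) = t * e.
  rewrite -(mulr_powRB1 (ltW t0)) ?divr_gt0 // -/b /t -powRrM mulVf ?gt_eqF //.
  by rewrite powRr1 // ltW.
have z01 : 0 <= 1 - t < 1 by lra.
have := ler_sums _ (sumsB sP (pF _ z01)) (sumsZ t mS).
rewrite (_ : 1 - (1 - t) = t); last ring.
rewrite tE => H.
suff /H : forall k, p k - p k * (1 - t) ^+ k <= t * (k%:R * p k).
  rewrite (_ : 1 - _ = t * (1 - r * e)); last ring.
  by rewrite ler_pM2l //; lra.
move=> k; have t01 : 0 <= 1 - t <= 1 by lra.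
have := @exprB_le _ (1 - t) 1 k; rewrite t01 expr1n lexx => /(_ isT isT).
by move=> /(ler_wpM2l (p0 k)); lra.
Qed.

End limits.

Unset Implicit Arguments.

Theorem theorem3 (R : realType) (q : nat -> R)
    (hq : offspring_distribution q) (hq0 : q 0%N < 1) :
  (critical q ->
     forall L : R, (1 - S_fun q x) / (1 - x) @[x --> 1^'-] --> L ->
     exists rho_star : set tree -> \bar R,
       is_IGW (1 - L) rho_star /\
       forall T : tree,
         pruned_law (GW q) k [set T] @[k --> \oo] --> rho_star [set T]) /\
  (subcritical q ->
     forall T : tree,
       pruned_law (GW q) k [set T] @[k --> \oo] --> GW (@leaf_offspring R) [set T]).
Proof.
have main (mean1 : (offspring_mean q <= 1)%E) (r : nat -> R) T : (forall j, 0 <= r j) ->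
    (forall j, iter k prune q j @[k --> \oo] --> r j) ->
    pruned_law (GW q) k [set T] @[k --> \oo] --> GW r [set T].
  move=> r0 qr; have hs : subcritical_offspring q by [].
  under eq_fun do rewrite (pruned_lawE _ hs).1.
  by apply: cvg_GW => // n k; have [_ [[]]] := pruned_lawE n hs.
have leaf_ge0 j : 0 <= @leaf_offspring R j by rewrite /leaf_offspring.
(* The ratio is the probability of having no offspring in the pruned law. *)
have leaf_case (hs : subcritical_offspring q) :
    gap q (newton q k) / (newton q k * dgap q (newton q k)) @[k --> \oo] --> (1 : R) ->
    forall T, pruned_law (GW q) k [set T] @[k --> \oo] --> GW (@leaf_offspring R) [set T].
  move=> H T; apply: main => //; first by case: hs.
  apply: cvg_leaf_offspring => [n|]; first by have [_] := pruned_lawE n hs.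
  by under eq_fun do rewrite iter_prune0 //.
split=> [cq L hL|sq].
  have hs : subcritical_offspring q by split => //; rewrite cq.
  have /andP[r2 r1] := ratio_range hs hL cq.
  have cv := gap_ratio_cvg hs hL (newton01 hs) (newton_cvg0 hs).
  have [rE|rN1] := eqVneq (1 - L) 1.
    exists (GW (@leaf_offspring R)); split; first by right.
    by apply: leaf_case => //; rewrite -rE.
  have r1' : 1 - L < 1 by rewrite lt_neqAle rN1.
  have r0 : 0 < 1 - L by lra.
  have hk k : subcritical_offspring (iter k prune q) by have [_] := pruned_lawE k hs.
  have p0 k j : 0 <= iter k prune q j by case: (hk k) => -[].
  have p1 k j : iter k prune q j <= 1 by exact: sums_term_le (p0 k) (offspring_sums (hk k)).
  have [|k z /andP[z0 z1]|z /andP[z0 z1]|r [qr rF]] := @pgf_continuity R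
      (fun k => iter k prune q) (fun k z => pgf (iter k prune q) z)
      (fun z => z + (1 - L) * (1 - z) `^ (1 / (1 - L))).
  - by move=> n j; rewrite p0 p1.
  - by apply: pgf_sums => //; rewrite (ltW z0) ltW.
  - by apply: pgf_iter_prune_cvg => //; rewrite ltW.
  have rge0 j : 0 <= r j by apply: cvgr_to_ge (qr j) _; exact: nearW.
  have rS n : series r n <= 1.
    have cvs : series (iter k prune q) n @[k --> \oo] --> series r n.
      rewrite /series /=.
      apply: (@cvg_big R _ _ _ _ _ _ _ _ (fun j k => iter k prune q j)) => //.
      exact: add_continuous.
    apply: cvgr_to_le cvs _; apply: nearW => k.
    exact: ge0_sums_ge (p0 k) (offspring_sums (hk k)).
  have rq1 : r 1 = 0.
    apply: (cvg_unique _ (qr 1)) => //.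
    apply: cvg_near_cst; apply: nearW => k; by case: (hk k) => -[].
  (* At z = 0 the generating function is its constant coefficient, whose limit
     is that of the ratios g(a) / (a g'(a)). *)
  have rF' z : 0 <= z < 1 ->
      sums (fun k => r k * z ^+ k) (z + (1 - L) * (1 - z) `^ (1 / (1 - L))).
    rewrite le_eqVlt => /andP[/orP[/eqP <- _|z0 z1]]; last by apply: rF; rewrite z0.
    have r0E : r 0 = 1 - L.
      have cv0 : iter k prune q 0 @[k --> \oo] --> 1 - L.
        by under eq_fun do rewrite iter_prune0 //.
      exact: (cvg_unique _ (qr 0) cv0).
    rewrite subr0 powR1 mulr1 add0r -r0E -[X in sums _ X]mulr1 -[X in sums _ (_ * X)](expr0 0).
    by apply: (@sums1 _ (fun k => r k * 0 ^+ k)) => -[|k] // _; rewrite expr0n mulr0.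
  have [hr cr] := IGW_offspring (introT andP (conj r2 r1')) rge0 rq1 rS rF'.
  exists (GW r); split.
    left; split; first by rewrite r2.
    by exists r; split => // z z01; rewrite /pgf /pseries (sums_lim (rF' z z01)).
  by move=> T; apply: main; rewrite // cq.
have hs : subcritical_offspring q by split => //; rewrite ltW.
by apply: leaf_case => //; exact: subcritical_ratio_cvg.
Qed.
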